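(* For every integer $n\ge 1$ there is a constant $C=C(n)$, depending only on $n$, such that the following holds. Let $\mathbb{F}$ be any field and let $k_1,\ldots,k_d\geq 1$ be integers with $k_1+\cdots+k_d=n$. Then for every finitely supported function $S:\mathbb{F}^n\to\mathbb{R}_{\ge 0}$ with $\|S\|_d=1$, there exist functions $s_{k_j}:\mathbb{F}^n\times \mathrm{Gr}(k_j,\mathbb{F}^n)\to\mathbb{R}_{\geq 0}$, $1\le j\le d$, such that \[(V_1\wedge\cdots\wedge V_d)\,S(p)^d\le C\prod_{j=1}^d s_{k_j}(p,V_j)\] for all $p\in\mathbb{F}^n$ and all $V_j\in\mathrm{Gr}(k_j,\mathbb{F}^n)$, $1\le j\le d$, and such that for every $1\le j\le d$ \[\sum_{p\in\pi_j}s_{k_j}(p,e(\pi_j))\le 1\] for all affine $k_j$-dimensional subspaces $\pi_j\subset\mathbb{F}^n$.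
   Context: $\mathrm{Gr}(k,\mathbb{F}^n)$ is the set of all $k$-dimensional linear subspaces of $\mathbb{F}^n$. For an affine $k$-plane $\pi\subset\mathbb{F}^n$, $e(\pi)\in\mathrm{Gr}(k,\mathbb{F}^n)$ is the translate of $\pi$ containing the origin. For linear subspaces $V_1,\ldots,V_d$ of $\mathbb{F}^n$ of dimensions $k_1,\ldots,k_d$ with $k_1+\cdots+k_d=n$, the discrete wedge product $V_1\wedge\cdots\wedge V_d\in\{0,1\}$ equals $1$ if $V_1,\ldots,V_d$ together span $\mathbb{F}^n$, and $0$ otherwise. $\|S\|_d=\left(\sum_{p}S(p)^d\right)^{1/d}$. The subscript in $s_{k_j}$ indicates that the function is indexed by the dimension $k_j$, so that $s_{k_i}=s_{k_j}$ whenever $k_i=k_j$. *)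

(* Defs.v *)
From HB Require Import structures.
From mathcomp Require Import all_boot all_order all_algebra.
From mathcomp Require Import all_classical all_reals all_analysis.

Set Implicit Arguments.
Unset Strict Implicit.
Unset Printing Implicit Defensive.

Import Order.TTheory GRing.Theory Num.Theory.

Local Open Scope classical_set_scope.
Local Open Scope ring_scope.

(* Leibniz equality on {vspace _} is equality of subspaces, so a function on
   Gr F n k is automatically a function of the subspace itself. *)
Definition Gr (F : fieldType) (n k : nat) : Type :=
  {V : {vspace 'rV[F]_n} | \dim V == k}.

(* edir is the translate of the plane through the origin. The equation
   determines edir from the plane (edir_uniq below) and, since 0 lies in edir,
   forces the plane to be nonempty. *)
Record affine_plane (F : fieldType) (n k : nat) := AffinePlane {
  plane_set :> set 'rV[F]_n;
  edir : Gr F n k;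
  edir_translate : exists a : 'rV[F]_n,
    [set v | v \in val edir] = [set p + a | p in plane_set]
}.

Lemma edir_uniq (F : fieldType) (n k : nat) (P Q : affine_plane F n k) :
  plane_set P = plane_set Q -> edir P = edir Q.
Proof.
case: P Q => [A U [a aU]] [B V [b bV]] /= AB; rewrite -{B}AB in bV.
have sub (X Y : {vspace 'rV[F]_n}) (x y : 'rV[F]_n) :
    [set v | v \in X] = [set p + x | p in A] ->
    [set v | v \in Y] = [set p + y | p in A] -> (X <= Y)%VS.
  move=> xX yY.
  have XY p : A p -> p + x \in X by move=> Ap; have : [set v | v \in X] (p + x)
    by rewrite xX; exists p.
  have YY p : A p -> p + y \in Y by move=> Ap; have : [set v | v \in Y] (p + y)
    by rewrite yY; exists p.
  have : [set v | v \in X] 0 by exact: mem0v.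
  rewrite xX => -[p0 Ap0 p0x].
  apply/subvP => v vX; have : [set v | v \in X] v by [].
  rewrite xX => -[p Ap <-].
  suff -> : p + x = (p + y) - (p0 + y) by rewrite rpredB ?YY.
  have -> : x = - p0 by apply/eqP; rewrite -addr_eq0 addrC p0x.
  by rewrite opprD addrACA subrr addr0.
apply: val_inj; apply/eqP; rewrite eqEsubv.
by rewrite (sub _ _ _ _ aU bV) (sub _ _ _ _ bV aU).
Qed.

Definition wedge (F : fieldType) (n d : nat)
    (V : 'I_d -> {vspace 'rV[F]_n}) : bool :=
  (\sum_(j < d) V j == fullv)%VS.

(* Meant for nonnegative finitely supported S and d >= 1: a \sum_(p \in _)
   with infinitely many nonzero terms is 0 by convention. *)
Definition dnorm (R : realType) (T : choiceType) (d : nat) (S : T -> R) : R :=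
  (\sum_(p \in [set: T]) S p ^+ d) `^ d%:R^-1.

(* Main.v *)
(* The polynomial method with handicaps. Let p_1, .., p_m be the support of S. On
   polynomials of degree at most N restricted to a k-plane, impose vanishing at
   the points p_i of the plane to higher and higher order, the point p_i lagging
   behind by its handicap gamma_i, and let b(p_i, V) count the conditions at p_i
   that are new when imposed, in the plane p_i + V. On a fixed plane the b's add
   up to the dimension 'C(k + N, k) of the space of polynomials.

   Conversely, if V_1, .., V_d span F^n, then in coordinates adapted to p_i and
   the V_j a coefficient of a polynomial, read as a function of its V_j-part, is
   a coefficient of a polynomial on p_i + V_j satisfying the earlier conditions
   there. So new conditions at p_i in F^n come only from products of new
   conditions in the planes p_i + V_j, and 'C(n + N, n) is at most the sum over i
   of the products of the b(p_i, V_j), for any choice of transversal V_j at each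
   p_i.

   Raising gamma_i lowers b(p_i, .), by O(N^(k-1)) only, and raises the other
   b(p_q, .). Raising repeatedly the handicap of a point with too large a share
   thus leads to handicaps for which, at every p_i, all the products are at least
   S(p_i)^d 'C(n + N, n) / 2. Then s(p, V) = b(p, V) / 'C(k + N, k) works. *)

Require Import Defs.
From HB Require Import structures.
From mathcomp Require Import all_boot all_order all_algebra.
From mathcomp Require Import all_classical all_reals all_analysis.
From mathcomp Require Import zify lra.
From mathcomp Require Import -(notations) mpoly.

Set Implicit Arguments.
Unset Strict Implicit.
Unset Printing Implicit Defensive.

Import Order.TTheory GRing.Theory Num.Theory.

Local Open Scope ring_scope.

(** * Order of vanishing at the origin, and degree *)

Section Polynomials.
Variable F : fieldType.

(** Order of vanishing is read on coefficients instead of derivatives, which makes it right in every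
    characteristic. The order at a point [q] is that of [restr q 1%:M g]. *)
Definition vord n r (g : mpoly n F) :=
  forall m : multinom n, (mdeg m < r)%N -> mcoeff m g = 0.

Definition degle n N (g : mpoly n F) :=
  forall m : multinom n, (N < mdeg m)%N -> mcoeff m g = 0.

Lemma vord_le n r s (g : mpoly n F) : (r <= s)%N -> vord s g -> vord r g.
Proof. by move=> rs gs m mr; apply: gs; apply: leq_trans rs. Qed.

Lemma vord0 n (g : mpoly n F) : vord 0 g.
Proof. by move=> m. Qed.

Lemma vordM n r s (f g : mpoly n F) :
  vord r f -> vord s g -> vord (r + s) (f * g).
Proof.
move=> fr gs m mrs; rewrite mcoeffM big1 // => -[[u hu] [v hv]] /= /eqP mE.
have [ur|ur] := ltnP (mdeg u) r; first by rewrite fr // mul0r.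
rewrite (gs v) ?mulr0 //; move: mrs; rewrite mE mdegD; lia.
Qed.

Lemma degleM n r s (f g : mpoly n F) :
  degle r f -> degle s g -> degle (r + s) (f * g).
Proof.
move=> fr gs m mrs; rewrite mcoeffM big1 // => -[[u hu] [v hv]] /= /eqP mE.
have [ur|ur] := ltnP r (mdeg u); first by rewrite fr // mul0r.
rewrite (gs v) ?mulr0 //; move: mrs; rewrite mE mdegD; lia.
Qed.

Lemma degle1 n : degle 0 (1 : mpoly n F).
Proof. by move=> m m0; rewrite mcoeff1 -mdeg_eq0 gtn_eqF. Qed.

Lemma vord_prodX n k (lq : k.-tuple (mpoly n F)) (m : multinom k) :
  (forall i, vord 1 (tnth lq i)) ->
  vord (mdeg m) (\prod_(i < k) tnth lq i ^+ m i).
Proof.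
move=> h1; rewrite mdegE.
apply: (big_rec2 (fun (a : nat) (b : mpoly n F) => vord a b)) => [|i a b _ ab].
  exact: vord0.
apply: vordM => //; elim: (m i) => [|e IH]; first exact: vord0.
by rewrite exprS -add1n; apply: vordM.
Qed.

Lemma degle_prodX n k (lq : k.-tuple (mpoly n F)) (m : multinom k) :
  (forall i, degle 1 (tnth lq i)) ->
  degle (mdeg m) (\prod_(i < k) tnth lq i ^+ m i).
Proof.
move=> h1; rewrite mdegE.
apply: (big_rec2 (fun (a : nat) (b : mpoly n F) => degle a b)) => [|i a b _ ab].
  exact: degle1.
apply: degleM => //; elim: (m i) => [|e IH]; first exact: degle1.
by rewrite exprS -add1n; apply: degleM.
Qed.

Lemma vord_comp n k r (lq : k.-tuple (mpoly n F)) (g : mpoly k F) :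
  (forall i, vord 1 (tnth lq i)) -> vord r g -> vord r (comp_mpoly lq g).
Proof.
move=> h1 gr m mr; rewrite comp_mpolyEX raddf_sum big1_seq //= => u ug.
rewrite mcoeffZ comp_mpolyX; have [ur|ur] := ltnP (mdeg u) r.
  by rewrite gr // mul0r.
by rewrite (vord_prodX h1) ?mulr0 // (leq_trans mr).
Qed.

Lemma degle_comp n k r (lq : k.-tuple (mpoly n F)) (g : mpoly k F) :
  (forall i, degle 1 (tnth lq i)) -> degle r g -> degle r (comp_mpoly lq g).
Proof.
move=> h1 gr m mr; rewrite comp_mpolyEX raddf_sum big1_seq //= => u ug.
rewrite mcoeffZ comp_mpolyX; have [ur|ur] := ltnP r (mdeg u).
  by rewrite gr // mul0r.
by rewrite (degle_prodX h1) ?mulr0 // (leq_ltn_trans ur).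
Qed.

Lemma degleE n N (g : mpoly n F) :
  degle N g ->
  g = \sum_(m : bmultinom n N.+1) mcoeff m g *: mpolyX F m.
Proof.
move=> gN; apply: mpolywE; rewrite msizeE; apply/bigmax_leqP_seq => m mg _.
by rewrite ltnS leqNgt; apply: contraTN mg => /gN; rewrite -mcoeff_eq0 => ->.
Qed.

Lemma degle_vord_eq0 n N (g : mpoly n F) : degle N g -> vord N.+1 g -> g = 0.
Proof.
move=> gN gv; apply/mpolyP => m; rewrite mcoeff0.
by have [/gN|/gv] := ltnP N (mdeg m).
Qed.

(** * Restriction of polynomials to parametrized planes *)

Definition afsub n k (q : 'rV[F]_n) (B : 'M[F]_(k, n)) : n.-tuple (mpoly k F) :=
  [tuple mpolyC k (q 0 i) + \sum_(j < k) B j i *: mpolyX F (mnm1 j) | i < n].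

(** Pullback along [x |-> q + x *m B]: for row-free [B], the restriction to the plane through [q] of
    direction [B], in the coordinates given by the rows of [B]. *)
Definition restr n k q (B : 'M[F]_(k, n)) (g : mpoly n F) : mpoly k F :=
  comp_mpoly (afsub q B) g.

HB.instance Definition _ n k q (B : 'M[F]_(k, n)) :=
  GRing.Linear.copy (restr q B) (comp_mpoly (afsub q B)).
HB.instance Definition _ n k q (B : 'M[F]_(k, n)) :=
  GRing.RMorphism.copy (restr q B) (comp_mpoly (afsub q B)).

Lemma restr_X n k q (B : 'M[F]_(k, n)) (i : 'I_n) :
  restr q B (mpolyX F (mnm1 i))
  = mpolyC k (q 0 i) + \sum_(j < k) B j i *: mpolyX F (mnm1 j).
Proof. by rewrite /restr comp_mpolyXU -tnth_nth tnth_mktuple. Qed.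

Lemma rmorph_mpoly_eq n (S : nzRingType) (f g : {rmorphism mpoly n F -> S}) :
  (forall c, f (mpolyC n c) = g (mpolyC n c)) ->
  (forall i, f (mpolyX F (mnm1 i)) = g (mpolyX F (mnm1 i))) -> f =1 g.
Proof.
move=> fgC fgX p; rewrite [p]mpolyE !rmorph_sum /=; apply: eq_bigr => m _.
rewrite -mul_mpolyC !rmorphM fgC; congr (_ * _).
rewrite mpolyXE_id !rmorph_prod; apply: eq_bigr => i _.
by rewrite !rmorphXn fgX.
Qed.

Lemma restrC n k q (B : 'M[F]_(k, n)) c : restr q B (mpolyC n c) = mpolyC k c.
Proof. exact: comp_mpolyC. Qed.

Lemma restr_comp n k l q (B : 'M[F]_(k, n)) q' (B' : 'M[F]_(l, k)) g :
  restr q' B' (restr q B g) = restr (q + q' *m B) (B' *m B) g.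
Proof.
pose f : {rmorphism _ -> _} := restr q' B' \o restr q B.
pose h : {rmorphism _ -> _} := restr (q + q' *m B) (B' *m B).
suff fh : f =1 h by exact: fh.
apply: rmorph_mpoly_eq => [c|i].
  have -> : h (mpolyC n c) = mpolyC l c by exact: restrC.
  have -> : f (mpolyC n c) = restr q' B' (restr q B (mpolyC n c)) by [].
  by rewrite !restrC.
have -> : f (mpolyX F (mnm1 i)) = restr q' B' (restr q B (mpolyX F (mnm1 i))).
  by [].
have -> : h (mpolyX F (mnm1 i)) =
  restr (q + q' *m B) (B' *m B) (mpolyX F (mnm1 i)) by [].
rewrite !restr_X raddfD raddf_sum /= restrC !mxE raddfD /= -addrA.
congr (_ + _).
under eq_bigr => j _ do rewrite linearZ /= restr_X scalerDr scaler_sumr.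
rewrite big_split /= exchange_big /=; congr (_ + _).
  rewrite raddf_sum /=; apply: eq_bigr => j _.
  by rewrite mulrC -mul_mpolyC -mpolyCM.
apply: eq_bigr => j _; rewrite mxE scaler_suml; apply: eq_bigr => j' _.
by rewrite scalerA mulrC.
Qed.

Lemma restr01 n (g : mpoly n F) : restr 0 1%:M g = g.
Proof.
pose h : {rmorphism _ -> _} := restr (0 : 'rV[F]_n) 1%:M.
suff hE : h =1 idfun by exact: hE.
apply: rmorph_mpoly_eq => [c|i]; first exact: restrC.
have -> : h (mpolyX F (mnm1 i)) = restr 0 1%:M (mpolyX F (mnm1 i)) by [].
rewrite restr_X mxE raddf0 add0r (bigD1 i) //= big1 ?addr0.
  by rewrite mxE eqxx scale1r.
by move=> j ji; rewrite mxE (negbTE ji) scale0r.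
Qed.

Lemma vord_linform n k (B : 'M[F]_(k, n)) i :
  vord 1 (\sum_(j < k) B j i *: mpolyX F (mnm1 j) : mpoly k F).
Proof.
move=> m; rewrite ltnS leqn0 mdeg_eq0 => /eqP ->; rewrite raddf_sum big1 //=.
by move=> j _; rewrite mcoeffZ mcoeffX mnm1_eq0 mulr0.
Qed.

Lemma degle_afsub n k q (B : 'M[F]_(k, n)) i : degle 1 (tnth (afsub q B) i).
Proof.
rewrite tnth_mktuple => m m1.
rewrite mcoeffD mcoeffC -mdeg_eq0 gtn_eqF ?(ltn_trans _ m1) // mulr0 add0r.
rewrite raddf_sum big1 //= => j _; rewrite mcoeffZ mcoeffX.
by case: eqP m1 => [<-|]; rewrite ?mdeg1 // mulr0.
Qed.

Lemma degle_restr n k N q (B : 'M[F]_(k, n)) g :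
  degle N g -> degle N (restr q B g).
Proof. by apply: degle_comp => i; apply: degle_afsub. Qed.

Lemma vord_restr n k r (B : 'M[F]_(k, n)) g : vord r g -> vord r (restr 0 B g).
Proof.
apply: vord_comp => i; rewrite tnth_mktuple mxE raddf0 add0r.
exact: vord_linform.
Qed.

Lemma vord_restr1 n k r q (B : 'M[F]_(k, n)) g :
  vord r (restr q 1%:M g) -> vord r (restr q B g).
Proof.
by move=> /(vord_restr B); rewrite restr_comp mul0mx addr0 mulmx1.
Qed.

Lemma vord_restr_unit n r q (B : 'M[F]_n) g :
  B \in unitmx -> vord r (restr q B g) -> vord r (restr q 1%:M g).
Proof.
by move=> uB /(vord_restr (invmx B)); rewrite restr_comp mul0mx addr0 mulVmx.
Qed.

Lemma restr1_eq0 n q (g : mpoly n F) : restr q 1%:M g = 0 -> g = 0.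
Proof.
move=> /(congr1 (restr (- q) 1%:M)).
by rewrite restr_comp raddf0 mulmx1 subrr mul1mx restr01.
Qed.

(* [extract a g] is the coefficient in [g], viewed as a polynomial in the
   variables outside the range of [iota], of the monomial [mrest a]. *)
Section Coefficients.
Variables (n k : nat) (iota : 'I_k -> 'I_n).
Hypothesis iota_inj : injective iota.

Definition mrange (b : multinom k) : multinom n :=
  Multinom [tuple (\sum_(j < k | iota j == i) b j)%N | i < n].
Definition mrest (a : multinom n) : multinom n :=
  Multinom [tuple (if [exists j, iota j == i] then 0 else a i)%N | i < n].
Definition mback (a : multinom n) : multinom k :=
  Multinom [tuple a (iota j) | j < k].

Lemma mrange_iota b j : mrange b (iota j) = b j.
Proof.
rewrite mnmE (bigD1 j) //= big1 ?addn0 // => j' /andP[/eqP /iota_inj ->].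
by rewrite eqxx.
Qed.

Lemma mrange_out b i : ~~ [exists j, iota j == i] -> mrange b i = 0%N.
Proof.
rewrite negb_exists => /forallP h; rewrite mnmE big_pred0 // => j.
exact: negbTE (h j).
Qed.

Lemma mback_rest a : (mnm_add (mrange (mback a)) (mrest a)) = a.
Proof.
apply/mnmP => i; rewrite mnmDE [mrest _ _]mnmE; case: ifP => [/existsP[j /eqP<-]|].
  by rewrite mrange_iota mnmE addn0.
by move=> /negbT /mrange_out ->.
Qed.

Lemma mback_add b a : mback (mnm_add (mrange b) (mrest a)) = b.
Proof.
apply/mnmP => j; rewrite mnmE mnmDE mrange_iota mnmE.
by case: ifP => [_|/existsP[]]; [rewrite addn0 | exists j].
Qed.

Lemma mrest_add b a : mrest (mnm_add (mrange b) (mrest a)) = mrest a.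
Proof.
apply/mnmP => i; rewrite ![mrest _ i]mnmE; case: ifP => // h.
by rewrite mnmDE mrange_out ?h // mnmE h.
Qed.

Lemma mdeg_mrange b : mdeg (mrange b) = mdeg b.
Proof.
rewrite !mdegE; under eq_bigr => i _ do rewrite mnmE big_mkcond.
rewrite exchange_big; apply: eq_bigr => j _ /=.
by rewrite -big_mkcond (big_pred1 (iota j)) // => i; rewrite eq_sym.
Qed.

Definition extract (a : multinom n) (g : mpoly n F) : mpoly k F :=
  \sum_(m <- msupp g)
    ((mrest m == mrest a)%:R * mcoeff m g) *: mpolyX F (mback m).

Lemma mcoeff_extract a g b :
  mcoeff b (extract a g) = mcoeff (mnm_add (mrange b) (mrest a)) g.
Proof.
rewrite raddf_sum /=; set c := mnm_add _ _.
have cE m : ((mrest m == mrest a) && (mback m == b)) = (m == c).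
  apply/andP/eqP => [[/eqP ma /eqP mb]|->]; last by rewrite mback_add mrest_add.
  by rewrite -(mback_rest m) ma mb.
under eq_bigr => m _ do
  rewrite mcoeffZ mcoeffX mulrAC -natrM mulnb cE mulr_natl mulrb.
have [cg|cg] := boolP (c \in msupp g).
  rewrite (bigD1_seq c) ?msupp_uniq //= eqxx big1 ?addr0 // => m.
  by move/negbTE ->.
rewrite big_seq big1 ?memN_msupp_eq0 // => m mg.
by case: eqP => // mc; rewrite -mc mg in cg.
Qed.

Fact extract_is_linear a : linear (extract a).
Proof.
move=> c f g; apply/mpolyP => m.
by rewrite mcoeffD mcoeffZ !mcoeff_extract mcoeffD mcoeffZ.
Qed.

HB.instance Definition _ a :=
  GRing.isLinear.Build F (mpoly n F) (mpoly k F) _ (extract a)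
    (extract_is_linear a).

Lemma degle_extract N a g : degle N g -> degle N (extract a g).
Proof.
move=> gN m mN; rewrite mcoeff_extract gN // mdegD mdeg_mrange.
exact: leq_trans (leq_addr _ _).
Qed.

(** A monomial of degree [e] in [extract a g] comes from one of degree [e + mdeg (mrest a)] in
    [g]. *)
Lemma vord_extract r a g :
  vord r g -> vord (r - mdeg (mrest a)) (extract a g).
Proof.
move=> gr m mr; rewrite mcoeff_extract gr // mdegD mdeg_mrange.
by rewrite addnC -ltn_subRL.
Qed.

Lemma extractX a m :
  extract a (mpolyX F m) = (mrest m == mrest a)%:R *: mpolyX F (mback m).
Proof. by rewrite /extract msuppX big_seq1 mcoeffX eqxx mulr1. Qed.

(** In [restr], this matrix is the inclusion of the coordinate subspace of the variables [iota j],
    and its transpose is the projection onto it. *)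
Definition incl_mx : 'M[F]_(k, n) := \matrix_(j, i) (iota j == i)%:R.

Lemma incl_mxK : incl_mx *m incl_mx^T = 1%:M.
Proof.
apply/matrixP => j j'; rewrite !mxE (bigD1 (iota j)) //= big1 ?addr0.
  by rewrite !mxE eqxx mul1r eq_sym (inj_eq iota_inj).
by move=> i; rewrite eq_sym !mxE => /negbTE ->; rewrite mul0r.
Qed.

Lemma restr_inclX (b : multinom k) :
  restr 0 incl_mx^T (mpolyX F b) = mpolyX F (mrange b).
Proof.
rewrite !mpolyXE_id rmorph_prod /=.
transitivity (\prod_(j < k) mpolyX F (mnm1 (iota j)) ^+ b j).
  apply: eq_bigr => j _; rewrite rmorphXn /= restr_X mxE raddf0 add0r.
  congr (_ ^+ _); rewrite (bigD1 (iota j)) //= big1 ?addr0.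
    by rewrite !mxE eqxx scale1r.
  by move=> i ij; rewrite !mxE eq_sym (negbTE ij) scale0r.
under [RHS]eq_bigr => i _ do rewrite mnmE -prodrXr big_mkcond.
rewrite exchange_big; apply: eq_bigr => j _ /=.
by rewrite -big_mkcond (big_pred1 (iota j)) // => i; rewrite eq_sym.
Qed.

Lemma restr1_X p q (i : 'I_p) :
  restr q 1%:M (mpolyX F (mnm1 i)) = mpolyC p (q 0 i) + mpolyX F (mnm1 i).
Proof.
rewrite restr_X (bigD1 i) //= big1 ?addr0 ?mxE ?eqxx ?scale1r // => j ji.
by rewrite mxE (negbTE ji) scale0r.
Qed.

Lemma restr_out (y : 'rV[F]_k) m :
  restr (y *m incl_mx) 1%:M (mpolyX F (mrest m)) = mpolyX F (mrest m).
Proof.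
rewrite !mpolyXE_id rmorph_prod /=; apply: eq_bigr => i _.
rewrite rmorphXn /= restr1_X mnmE; case: ifP => [|/negbT].
  by rewrite !expr0.
rewrite negb_exists => /forallP h; rewrite !mxE big1 ?raddf0 ?add0r // => j _.
by rewrite mxE (negbTE (h j)) mulr0.
Qed.

Lemma extract_mul_range a m (f : mpoly k F) :
  extract a (restr 0 incl_mx^T f * mpolyX F (mrest m))
  = (mrest m == mrest a)%:R *: f.
Proof.
rewrite [f]mpolyE raddf_sum /= mulr_suml scaler_sumr raddf_sum /=.
apply: eq_bigr => b _; rewrite linearZ /= -scalerAl linearZ /= restr_inclX.
by rewrite -mpolyXD extractX mrest_add mback_add !scalerA mulrC.
Qed.

(** A translation along the block fixes the variables outside it, hence commutes with taking
    coefficients with respect to them. By linearity it is enough to treat monomials. *)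
Lemma restr_extract (y : 'rV[F]_k) a g :
  restr y 1%:M (extract a g) = extract a (restr (y *m incl_mx) 1%:M g).
Proof.
have extX m : restr y 1%:M (extract a (mpolyX F m)) =
    extract a (restr (y *m incl_mx) 1%:M (mpolyX F m)).
  rewrite extractX linearZ /= -{3}(mback_rest m) mpolyXD rmorphM /= restr_out.
  rewrite -restr_inclX.
  suff -> : restr (y *m incl_mx) 1%:M (restr 0 incl_mx^T (mpolyX F (mback m))) =
      restr 0 incl_mx^T (restr y 1%:M (mpolyX F (mback m))).
    by rewrite extract_mul_range.
  by rewrite !restr_comp -mulmxA incl_mxK !mulmx1 mul1mx add0r addr0.
have eL (G : {linear mpoly n F -> mpoly k F}) :
    G g = \sum_(m <- msupp g) mcoeff m g *: G (mpolyX F m).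
  by rewrite [in LHS](mpolyE g) linear_sum; apply: eq_bigr => m _; rewrite linearZ.
have E1 := eL (restr y 1%:M \o extract a).
have E2 := eL (extract a \o restr (y *m incl_mx) 1%:M).
rewrite -[LHS]/((restr y 1%:M \o extract a) g) E1.
rewrite -[RHS]/((extract a \o restr (y *m incl_mx) 1%:M) g) E2.
by apply: eq_bigr => m _; rewrite /= extX.
Qed.

End Coefficients.
End Polynomials.

(** * Counting independent linear conditions *)

Section Codimension.
Variables (F : fieldType) (E : vectType F).
Implicit Types X Y K : {vspace E}.

(** The number of independent conditions that membership in [K] imposes on [X]. *)
Definition codim X K := (\dim X - \dim (X :&: K))%N.

Lemma codimE X K : (\dim (X :&: K) + codim X K)%N = \dim X.
Proof. by rewrite subnKC // dimvS // capvSl. Qed.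

(** [codim X K] is the dimension of the image of [X] modulo [K], that is, of [X + K] modulo [K]. *)
Lemma codim_sub X Y K : (X <= Y + K)%VS -> (codim X K <= codim Y K)%N.
Proof.
move=> XYK; have := dimvS (_ : X + K <= Y + K)%VS.
rewrite subv_add XYK addvSr => /(_ isT).
by rewrite /codim; have := dimv_sum_cap X K; have := dimv_sum_cap Y K; lia.
Qed.

Lemma codim0 X K : (X <= K)%VS -> codim X K = 0%N.
Proof. by move=> /capv_idPl XK; rewrite /codim XK subnn. Qed.

Lemma dim_cap_lker X (f : 'Hom(E, F^o)) :
  (\dim X <= (\dim (X :&: lker f)).+1)%N.
Proof.
rewrite -(limg_ker_dim f X) -addn1 leq_add2l.
by apply: leq_trans (dimvS (subvf _)) _; rewrite dimvf.
Qed.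

(** Each functional lowers the dimension by at most one, and nothing but 0 survives all of them. *)
Lemma dim_le_functionals (A : finType) (phi : A -> 'Hom(E, F^o)) X :
  (forall x, x \in X -> (forall a, phi a x = 0) -> x = 0) -> (\dim X <= #|A|)%N.
Proof.
move=> h; suff: (\dim X <= \dim (X :&: \bigcap_(a <- enum A) lker (phi a)) +
    size (enum A))%N.
  rewrite -cardE => /leq_trans; apply; rewrite -[X in (_ <= X)%N]add0n leq_add2r.
  rewrite leqn0 dimv_eq0 -subv0; apply/subvP => x /memv_capP[xX xk].
  rewrite memv0; apply/eqP/h => // a.
  apply/eqP; rewrite -memv_ker; apply: subvP xk.
  by rewrite big_enum; apply: (bigcapv_inf a).
elim: (enum A) => [|a s IH]; first by rewrite big_nil capvf addn0.
apply: leq_trans IH _; rewrite big_cons [(lker _ :&: _)%VS]capvC capvA /= addnS.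
by rewrite -addSn leq_add2r dim_cap_lker.
Qed.

(** Greedy choice: some functional is nonzero at an [x] in [X] outside [K]. Cutting [X] by its
    kernel loses [x] but nothing of [K], so the codimension drops. *)
Lemma pivot (A : finType) (phi : A -> 'Hom(E, F^o)) X K :
  (forall a, K <= lker (phi a))%VS ->
  (forall x, x \in X -> (forall a, phi a x = 0) -> x \in K) ->
  exists S : {set A}, (#|S| <= codim X K)%N /\
    forall x, x \in X -> (forall a, a \in S -> phi a x = 0) -> x \in K.
Proof.
move=> Kphi; have [e] := ubnP (codim X K); elim: e X => // e IH X Xe h.
have [XK|] := boolP (X <= K)%VS.
  by exists finset.set0; rewrite cards0; split=> // x xX _; apply: subvP xX.
case/subvPn => x xX xK.
have [a pax] : exists a, phi a x != 0.
  apply/existsP; apply: contraNT xK => /existsPn nx; apply: h => // a.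
  exact/eqP/negPn.
have XaX : (X :&: lker (phi a) <= X)%VS := capvSl _ _.
have ltX : (codim (X :&: lker (phi a)) K < codim X K)%N.
  have capK : ((X :&: lker (phi a)) :&: K = X :&: K)%VS.
    by rewrite -capvA; congr (_ :&: _)%VS; apply/capv_idPr.
  rewrite /codim capK; have [le eqd] := dimv_leqif_sup XaX.
  suff : (\dim (X :&: lker (phi a)) < \dim X)%N.
    by have := dimvS (capvSl X K); have := dimvS (capvSl (X :&: lker (phi a)) K);
       rewrite capK; lia.
  rewrite ltn_neqAle le eqd andbT; apply: contra pax => /subvP /(_ x xX).
  by rewrite memv_cap memv_ker => /andP[].
case: (IH _ (leq_trans ltX Xe)) => [x' |S [Sc Sh]].
  by rewrite memv_cap => /andP[x'X _]; apply: h.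
exists (a |: S)%SET; split=> [|x' x'X x'S].
  rewrite cardsU1; apply: leq_trans ltX.
  by rewrite -add1n leq_add // leq_b1.
apply: Sh => [|b bS]; last by rewrite x'S // in_setU1 bS orbT.
by rewrite memv_cap x'X memv_ker x'S ?eqxx // setU11.
Qed.
End Codimension.

(** * The space of polynomials of degree at most [D], and its subspaces *)

Section Ambient.
Variables (F : fieldType) (n D : nat).

(** Row vectors of coefficients provide the finite-dimensional space that [{vspace _}] needs. The
    polynomials of interest have degree at most some [N <= D]; keeping [D] apart leaves room to
    multiply them. *)
Definition psp : vectType F := 'rV[F]_#|{: bmultinom n D.+1}|.

Definition topoly (v : psp) : mpoly n F :=
  \sum_(m : bmultinom n D.+1) v 0 (enum_rank m) *: mpolyX F m.

Definition ofpoly (g : mpoly n F) : psp :=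
  \row_i mcoeff (bmnm (enum_val i)) g.

Fact topoly_is_linear : linear topoly.
Proof.
move=> c u v; rewrite /topoly scaler_sumr -big_split; apply: eq_bigr => m _ /=.
by rewrite !mxE scalerDl scalerA.
Qed.
HB.instance Definition _ :=
  GRing.isLinear.Build F psp (mpoly n F) _ topoly topoly_is_linear.

Lemma ofpolyK N g : degle N g -> (N <= D)%N -> topoly (ofpoly g) = g.
Proof.
move=> gN ND; rewrite [RHS](degleE (N := D)) => [|m Dm].
  by apply: eq_bigr => m _; rewrite mxE enum_rankK.
by rewrite gN // (leq_ltn_trans ND).
Qed.

Lemma degle_topoly v : degle D (topoly v).
Proof.
move=> m Dm; rewrite /topoly raddf_sum big1 // => u _ /=.
rewrite mcoeffZ mcoeffX; case: eqP => [um|]; last by rewrite mulr0.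
by have := bmdeg u; rewrite um ltnS leqNgt Dm.
Qed.

Lemma topoly_eq0 v : topoly v = 0 -> v = 0.
Proof.
move=> v0; apply/rowP => i; rewrite mxE.
have := congr1 (mcoeff (bmnm (enum_val i))) v0.
rewrite mcoeff0 raddf_sum (bigD1 (enum_val i)) //= big1 ?addr0 => [|m mi].
  by rewrite mcoeffZ mcoeffX eqxx mulr1 enum_valK.
by rewrite mcoeffZ mcoeffX -bmeqP (negbTE mi) mulr0.
Qed.

Section Coefficient.
Variables (k : nat) (q : 'rV[F]_n) (B : 'M[F]_(k, n)) (a : multinom k).
Definition rcoef_fun (v : psp) : F^o := mcoeff a (restr q B (topoly v)).
Fact rcoef_is_linear : linear rcoef_fun.
Proof. by move=> c u v; rewrite /rcoef_fun !linearP. Qed.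
HB.instance Definition _ :=
  GRing.isLinear.Build F psp F^o _ rcoef_fun rcoef_is_linear.
Definition rcoef : 'Hom(psp, F^o) := linfun rcoef_fun.
Lemma rcoefE v : rcoef v = mcoeff a (restr q B (topoly v)).
Proof. by rewrite lfunE. Qed.
End Coefficient.

Definition degsp N : {vspace psp} :=
  (\bigcap_(a : bmultinom n D.+1 | (N < mdeg a)%N) lker (rcoef 0 1%:M a))%VS.

Definition ordsp k q (B : 'M[F]_(k, n)) r : {vspace psp} :=
  (\bigcap_(a : bmultinom k D.+1 | (mdeg a < r)%N) lker (rcoef q B a))%VS.

Lemma memv_bigcapP (E : vectType F) (I : finType) (P : pred I)
    (U : I -> {vspace E}) v :
  reflect (forall i, P i -> v \in U i) (v \in \bigcap_(i | P i) U i)%VS.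
Proof.
apply: (iffP idP) => [h i Pi|h].
  exact: (subvP (bigcapv_inf i Pi (subvv _)) v h).
apply: (big_rec (fun W : {vspace E} => v \in W)) => [|i W Pi vW].
  exact: memvf.
by rewrite memv_cap h.
Qed.

Lemma mem_degsp N v : reflect (degle N (topoly v)) (v \in degsp N).
Proof.
apply: (iffP (memv_bigcapP _ _ _)) => [h m Nm|h a aN].
  have [Dm|mD] := ltnP D (mdeg m); first exact: degle_topoly.
  have := h (BMultinom (mD : mdeg m < D.+1)%N) Nm.
  by rewrite memv_ker rcoefE restr01 => /eqP.
by rewrite memv_ker rcoefE restr01 h.
Qed.

Lemma mem_ordsp k q (B : 'M[F]_(k, n)) r v :
  reflect (vord r (restr q B (topoly v))) (v \in ordsp q B r).
Proof.
apply: (iffP (memv_bigcapP _ _ _)) => [h m rm|h a ar].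
  have [Dm|mD] := ltnP D (mdeg m); first by apply: degle_restr Dm; apply: degle_topoly.
  have := h (BMultinom (mD : mdeg m < D.+1)%N) rm.
  by rewrite memv_ker rcoefE => /eqP.
by rewrite memv_ker rcoefE h.
Qed.

Lemma ordsp0 k q (B : 'M[F]_(k, n)) : ordsp q B 0 = fullv.
Proof. by apply/vspaceP => v; rewrite memvf; apply/mem_ordsp/vord0. Qed.

Lemma mem_ordsp_top k q (B : 'M[F]_(k, n)) r v : (D < r)%N ->
  reflect (restr q B (topoly v) = 0) (v \in ordsp q B r).
Proof.
move=> Dr; apply: (iffP (mem_ordsp _ _ _ _)) => [h|->].
  by apply: (degle_vord_eq0 (N := D)) (vord_le Dr h); apply/degle_restr/degle_topoly.
by move=> m _; rewrite mcoeff0.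
Qed.

Lemma restr_translate k q q' (B : 'M[F]_(k, n)) g :
  (q' - q <= B)%MS -> restr q B g = 0 -> restr q' B g = 0.
Proof.
case/submxP => y yq h; have := restr_comp q B y 1%:M g.
by rewrite h raddf0 mul1mx -yq addrC subrK.
Qed.

(** Above the degree, vanishing at one point of a plane is vanishing on the whole plane, so neither
    the point nor the order matters any more. *)
Lemma ordsp_top k q q' (B : 'M[F]_(k, n)) r s : (D < r)%N -> (D < s)%N ->
  (q' - q <= B)%MS -> ordsp q B r = ordsp q' B s.
Proof.
move=> Dr Ds qq; apply/vspaceP => v.
apply/(mem_ordsp_top _ _ _ Dr)/(mem_ordsp_top _ _ _ Ds); apply: restr_translate.
  by [].
by rewrite -opprB eqmx_opp.
Qed.

(** Restriction to the plane maps polynomials of degree at most [N] onto all polynomials of degree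
    at most [N] in [k] variables, and its kernel is the intersection with [ordsp q B D.+1]. *)
Lemma codim_degsp k q (B : 'M[F]_(k, n)) N : row_free B -> (N <= D)%N ->
  codim (degsp N) (ordsp q B D.+1) = #|{: bmultinom k N.+1}|.
Proof.
move=> rB ND.
pose f (v : psp) : 'rV[F]_#|{: bmultinom k N.+1}| :=
  \row_i mcoeff (bmnm (enum_val i)) (restr q B (topoly v)).
have fL : linear f.
  by move=> c u v; apply/rowP => i; rewrite !mxE !linearP.
pose fl : {linear psp -> 'rV[F]_#|{: bmultinom k N.+1}|} :=
  HB.pack f (GRing.isLinear.Build _ _ _ _ f fL).
have kerE : (degsp N :&: ordsp q B D.+1 = degsp N :&: lker (linfun fl))%VS.
  apply/vspaceP => v; rewrite !memv_cap; apply: andb_id2l => /mem_degsp vN.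
  rewrite memv_ker lfunE /=; apply/mem_ordsp_top/eqP => // [rv0|fv0].
    by apply/rowP => i; rewrite !mxE rv0 mcoeff0.
  have := degle_restr q B vN => /degleE ->; rewrite big1 // => m _.
  have := congr1 (fun w : 'rV__ => w 0 (enum_rank m)) fv0.
  by rewrite !mxE enum_rankK => ->; rewrite scale0r.
rewrite /codim kerE -(limg_ker_dim (linfun fl) (degsp N)) addKn.
suff -> : (linfun fl @: degsp N = fullv)%VS.
  by rewrite dimvf dim_matrix; exact: mul1n.
apply/eqP; rewrite eqEsubv subvf /=; apply/subvP => w _.
pose h : mpoly k F := \sum_(m : bmultinom k N.+1) w 0 (enum_rank m) *: mpolyX F m.
(* [P] is a right inverse of [B], so [x |-> (x - q) *m P] recovers the coordinates on the plane;
   composing [h] with it extends [h] to the whole space without raising its degree. *)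
pose P := pinvmx B.
pose g := restr (- (q *m P)) P h.
have hN : degle N h.
  move=> m Nm; rewrite raddf_sum big1 //= => u _.
  rewrite mcoeffZ mcoeffX; case: eqP => [um|]; last by rewrite mulr0.
  by have := bmdeg u; rewrite um ltnS leqNgt Nm.
have gN : degle N g by apply: degle_restr.
have gK : topoly (ofpoly g) = g by apply: ofpolyK gN ND.
apply/memv_imgP; exists (ofpoly g); first by apply/mem_degsp; rewrite gK.
rewrite (lfunE fl) /=; apply/rowP => i; rewrite mxE gK /g restr_comp addNr mulmxVp //.
rewrite restr01 raddf_sum (bigD1 (enum_val i)) //= big1 ?addr0 => [|m mi].
  by rewrite mcoeffZ mcoeffX eqxx mulr1 enum_valK.
by rewrite mcoeffZ mcoeffX -bmeqP (negbTE mi) mulr0.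
Qed.

Lemma dim_degsp N : (N <= D)%N -> \dim (degsp N) = #|{: bmultinom n N.+1}|.
Proof.
move=> ND; rewrite -(codim_degsp 0 (_ : row_free 1%:M) ND); last first.
  by rewrite row_free_unit unitmx1.
suff z0 : ordsp 0 1%:M D.+1 = 0%VS by rewrite /codim z0 capv0 dimv0 subn0.
apply/eqP; rewrite -subv0; apply/subvP => v /mem_ordsp_top vZ.
by rewrite memv0; apply/eqP/topoly_eq0; rewrite -[LHS]restr01 vZ.
Qed.
End Ambient.

(** Exponent vectors of degree at most [N] are the tuples over ['I_N.+1] counted by
    [card_partial_ord_partitions]. *)
Lemma card_bmultinom k N : #|{: bmultinom k N.+1}| = 'C(k + N, k).
Proof.
rewrite -card_partial_ord_partitions.
pose f (a : bmultinom k N.+1) : k.-tuple 'I_N.+1 := [tuple inord (bmnm a i) | i < k].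
have fE a i : tnth (f a) i = bmnm a i :> nat.
  rewrite tnth_mktuple inordK //; apply: leq_ltn_trans (bmdeg a).
  by rewrite mdegE (bigD1 i) //= leq_addr.
have f_inj : injective f.
  by move=> a b ab; apply/val_inj/mnmP => i; rewrite -!fE ab.
rewrite -cardsT -(card_imset _ f_inj); apply: eq_card => t; rewrite inE.
apply/imsetP/idP => [[a _ ->]|tN].
  rewrite big_tuple; under eq_bigr => i _ do rewrite fE.
  by rewrite -mdegE -ltnS bmdeg.
have tdeg : (mdeg (Multinom [tuple tnth t i : nat | i < k]) < N.+1)%N.
  by rewrite ltnS mdegE; under eq_bigr => i _ do rewrite mnmE; rewrite big_tuple in tN.
exists (BMultinom tdeg) => //; apply: eq_from_tnth => i.
by apply: val_inj; rewrite [RHS]fE mnmE.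
Qed.

(** * Vanishing conditions with handicaps, and the gains *)

Section Configuration.
Variables (F : fieldType) (n D m : nat) (pts : 'I_m -> 'rV[F]_n).
Implicit Types (gam : 'I_m -> nat) (tau N r : nat).

(* Vanishing conditions are imposed in rounds: round [tau] runs through the
   points in order and asks order of vanishing [tau.+1 - gam q] at [pts q].
   [threshold gam tau i q] is the order required at [pts q] in round [tau] just
   before the turn of [pts i]; the truncated subtractions make it 0 as long as
   the handicap [gam q] is not used up. *)
Definition threshold gam tau i (q : 'I_m) := ((tau + (q < i)) - gam q)%N.

(** The polynomials that have passed all conditions imposed, at the points of the plane through [c],
    before turn [i] of round [tau]. Here [i] is a natural number, [i = m] being the end of the
    round. *)
Definition stage k N gam (c : 'rV_n) (B : 'M[F]_(k, n)) tau i : {vspace psp F n D} :=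
  (degsp F n D N :&: \bigcap_(q | (pts q - c <= B)%MS)
     ordsp D (pts q) B (threshold gam tau i q))%VS.

(* The number of conditions at [pts i] that are new when imposed, among
   polynomials on the plane through [pts i] with direction [B]. The polynomials
   stay polynomials in [n] variables, [codim] being insensitive to their part
   vanishing on the plane. *)
Definition gain k N gam (B : 'M[F]_(k, n)) (i : 'I_m) : nat :=
  \sum_(r < D.+1) codim (stage N gam (pts i) B (r + gam i) i)
                        (ordsp D (pts i) B r.+1).

Lemma mem_stage k N gam c (B : 'M[F]_(k, n)) tau i v :
  reflect (degle N (topoly v) /\ forall q, (pts q - c <= B)%MS ->
             vord (threshold gam tau i q) (restr (pts q) B (topoly v)))
          (v \in stage N gam c B tau i).
Proof.
rewrite memv_cap; apply: (iffP andP) => [[/mem_degsp vN /memv_bigcapP h]|[vN h]].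
  by split=> // q qB; apply/mem_ordsp/h.
by split; [apply/mem_degsp | apply/memv_bigcapP => q qB; apply/mem_ordsp/h].
Qed.

Lemma plane_eq k c c' (B : 'M[F]_(k, n)) q :
  (c' - c <= B)%MS -> (pts q - c <= B)%MS = (pts q - c' <= B)%MS.
Proof.
move=> cB; apply/idP/idP => h.
  have -> : pts q - c' = (pts q - c) - (c' - c) by rewrite opprB addrA subrK.
  by rewrite addmx_sub // eqmx_opp.
by rewrite -(subrK c' (pts q)) -addrA addmx_sub.
Qed.

Lemma stage_translate k N gam c c' (B : 'M[F]_(k, n)) tau i :
  (c' - c <= B)%MS -> stage N gam c B tau i = stage N gam c' B tau i.
Proof.
by move=> cB; congr (_ :&: _)%VS; apply: eq_bigl => q; apply: plane_eq.
Qed.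

Lemma stage0 k N gam c (B : 'M[F]_(k, n)) : stage N gam c B 0 0 = degsp F n D N.
Proof.
apply/vspaceP => v; apply/mem_stage/mem_degsp => [[]//|vN]; split=> // q _.
Qed.

Lemma stage_wrap k N gam c (B : 'M[F]_(k, n)) tau :
  stage N gam c B tau m = stage N gam c B tau.+1 0.
Proof.
congr (_ :&: _)%VS; apply: eq_bigr => q _; congr ordsp.
by rewrite /threshold ltn_ord ltn0 addn1 addn0.
Qed.

Lemma stageS_out k N gam c (B : 'M[F]_(k, n)) tau (i : 'I_m) :
  ~~ ((pts i - c)%R <= B)%MS ->
  stage N gam c B tau i.+1 = stage N gam c B tau i.
Proof.
move=> iB; congr (_ :&: _)%VS; apply: eq_bigr => q qB; congr ordsp.
rewrite /threshold ltnS leq_eqVlt; suff /negbTE -> : q != i :> nat by [].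
by apply: contraNneq iB => /val_inj <-.
Qed.

Lemma stageS_in k N gam c (B : 'M[F]_(k, n)) tau (i : 'I_m) :
  ((pts i - c)%R <= B)%MS ->
  stage N gam c B tau i.+1 =
  (stage N gam c B tau i :&: ordsp D (pts i) B (tau.+1 - gam i))%VS.
Proof.
move=> iB; apply/vspaceP => v; rewrite memv_cap.
apply/mem_stage/andP => [[vN h]|[/mem_stage[vN h] /mem_ordsp hi]].
  split; last first.
    apply/mem_ordsp; have := h i iB.
    by rewrite /threshold ltnSn addn1.
  apply/mem_stage; split=> // q qB; apply: vord_le (h q qB).
  by rewrite /threshold; lia.
split=> // q qB; have [->|qi] := eqVneq q i.
  by rewrite /threshold ltnSn addn1.
apply: vord_le (h q qB); rewrite /threshold.
have : (q : nat) <> i by move/val_inj => qi'; rewrite qi' eqxx in qi.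
lia.
Qed.

Lemma codim_step k N gam c (B : 'M[F]_(k, n)) tau (i : 'I_m) :
  ((pts i - c)%R <= B)%MS ->
  (\dim (stage N gam c B tau i.+1) +
   codim (stage N gam c B tau i) (ordsp D (pts i) B (tau.+1 - gam i)))%N
  = \dim (stage N gam c B tau i).
Proof. by move=> iB; rewrite stageS_in // codimE. Qed.

(** Telescoping over the turns of one round; turns of points off the plane leave the stage
    unchanged. *)
Lemma sum_codim_round k N gam c (B : 'M[F]_(k, n)) tau :
  (\dim (stage N gam c B tau.+1 0) + \sum_(i < m | ((pts i - c)%R <= B)%MS)
   codim (stage N gam c B tau i) (ordsp D (pts i) B (tau.+1 - gam i)))%N
  = \dim (stage N gam c B tau 0).
Proof.
rewrite -stage_wrap.
pose G (j : nat) := (\sum_(i < m | (((pts i - c)%R <= B)%MS) && (i < j)%N)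
   codim (stage N gam c B tau i) (ordsp D (pts i) B (tau.+1 - gam i)))%N.
have GE j : (j <= m)%N ->
   (\dim (stage N gam c B tau j) + G j)%N = \dim (stage N gam c B tau 0).
  elim: j => [|j IH] jm.
    by rewrite /G big_pred0 ?addn0 // => i; rewrite ltn0 andbF.
  rewrite -(IH (ltnW jm)); pose i := Ordinal jm.
  have Gj : G j.+1 = ((if ((pts i - c)%R <= B)%MS then
       codim (stage N gam c B tau j) (ordsp D (pts i) B (tau.+1 - gam i))
       else 0) + G j)%N.
    rewrite /G; case: ifP => iB.
      rewrite (bigD1 i) /=; last by rewrite iB ltnSn.
      congr (_ + _)%N; apply: eq_bigl => x; rewrite -andbA; congr (_ && _).
      rewrite ltnS [RHS]ltn_neqAle andbC; congr (_ && _).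
    rewrite add0n; apply: eq_bigl => x.
    have [->|xi] := eqVneq x i; first by rewrite iB.
    rewrite ltnS [RHS]andbC [LHS]andbC; congr (_ && _).
    by rewrite [RHS]ltn_neqAle (_ : x != j :> nat).
  rewrite Gj addnA; congr (_ + _)%N; case: ifP => [iB|/negbT iB].
    exact: (@codim_step _ N gam c B tau i iB).
  by rewrite addn0 (@stageS_out _ N gam c B tau i iB).
rewrite -(GE m (leqnn _)); congr (_ + _)%N; apply: eq_bigl => i.
by rewrite ltn_ord andbT.
Qed.

Lemma sum_codim_rounds k N gam c (B : 'M[F]_(k, n)) T :
  (\dim (stage N gam c B T 0) + \sum_(i < m | ((pts i - c)%R <= B)%MS) \sum_(tau < T)
   codim (stage N gam c B tau i) (ordsp D (pts i) B (tau.+1 - gam i)))%N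
  = \dim (degsp F n D N).
Proof.
rewrite exchange_big /=; elim: T => [|T IH]; first by rewrite big_ord0 addn0 stage0.
by rewrite big_ord_recr /= addnA addnAC sum_codim_round.
Qed.

(** The gain, recounted by rounds. Before round [gam i] nothing is asked at [pts i]; from round
    [D.+1 + gam i] on nothing is new, since the order already required exceeds [D] and means
    vanishing on the plane. *)
Lemma gain_translate k N gam c (B : 'M[F]_(k, n)) (i : 'I_m) T :
  ((pts i - c)%R <= B)%MS -> (D.+1 + gam i <= T)%N ->
  gain N gam B i =
  \sum_(tau < T)
   codim (stage N gam c B tau i) (ordsp D (pts i) B (tau.+1 - gam i)).
Proof.
move=> iB DT; pose f tau := codim (stage N gam c B tau i) (ordsp D (pts i) B (tau.+1 - gam i)).
have f_before tau : (tau < gam i)%N -> f tau = 0%N.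
  rewrite /f -subn_eq0 => /eqP ->; rewrite ordsp0 codim0 ?subvf //.
have f_after tau : (D.+1 + gam i <= tau)%N -> f tau = 0%N.
  move=> Dtau; apply: codim0; apply/subvP => v /mem_stage[_ /(_ i iB)].
  rewrite /threshold ltnn addn0 => vi.
  rewrite -(@ordsp_top _ _ D _ (pts i) _ B (tau - gam i)) ?subrr ?sub0mx //; try lia.
  exact/mem_ordsp.
transitivity (\sum_(0 <= tau < T) f tau)%N; last by rewrite big_mkord.
rewrite (@big_cat_nat _ _ _ (gam i)) //=; last by apply: leq_trans DT; apply: leq_addl.
rewrite big_nat big1 ?add0n => [|tau /andP[_]]; last exact: f_before.
rewrite (@big_cat_nat _ _ _ (D.+1 + gam i)) //= ?leq_addl //.
rewrite [in RHS]addnC big_nat big1 ?add0n => [|tau /andP[+ _]]; last exact: f_after.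
rewrite -[gam i in RHS]add0n big_addn add0n addnK big_mkord; apply: eq_bigr => r _.
by rewrite /f (stage_translate _ _ _ _ iB) -addSn addnK.
Qed.

(** The gains telescope from all polynomials of degree at most [N] down to those vanishing on the
    plane. The point [i0] ensures that some condition is imposed at all. *)
Lemma sum_gain k N gam c (B : 'M[F]_(k, n)) (i0 : 'I_m) :
  row_free B -> (N <= D)%N -> (pts i0 - c <= B)%MS ->
  (\sum_(i < m | ((pts i - c)%R <= B)%MS) gain N gam B i)%N = 'C(k + N, k).
Proof.
move=> rB ND i0B; rewrite -card_bmultinom -(codim_degsp (D := D) c rB ND).
(* Enough rounds for the order required at every point to exceed [D]. *)
pose T := (D.+1 + \sum_i gam i)%N.
have gT (i : 'I_m) : (D.+1 + gam i <= T)%N by rewrite leq_add2l (bigD1 i) //= leq_addr.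
under eq_bigr => i iB do rewrite (gain_translate N iB (gT i)).
rewrite /codim -(sum_codim_rounds N gam c B T).
suff -> : (degsp F n D N :&: ordsp D c B D.+1 = stage N gam c B T 0)%VS.
  by rewrite addKn.
have topE q r : (D < r)%N -> (pts q - c <= B)%MS ->
    ordsp D c B D.+1 = ordsp D (pts q) B r.
  by move=> Dr qB; apply: ordsp_top.
have thrT q : (D < threshold gam T 0 q)%N.
  by rewrite /threshold ltn0 addn0 ltn_subRL addnC -addSn.
apply/vspaceP => v; rewrite memv_cap; apply/andP/mem_stage.
  move=> [/mem_degsp vN vZ]; split=> // q qB; apply/mem_ordsp.
  by rewrite -(topE q).
move=> [vN h]; split; first exact/mem_degsp.
by rewrite (topE i0 _ (thrT i0)) //; apply/mem_ordsp/h.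
Qed.

Lemma sum_gain_le k N gam c (B : 'M[F]_(k, n)) :
  row_free B -> (N <= D)%N ->
  (\sum_(i < m | ((pts i - c)%R <= B)%MS) gain N gam B i <= 'C(k + N, k))%N.
Proof.
move=> rB ND; have [/existsP[i0 i0B]|] := boolP [exists i, ((pts i - c)%R <= B)%MS].
  by rewrite (sum_gain gam rB ND i0B).
by rewrite negb_exists => /forallP h; rewrite big_pred0 // => i; apply/negbTE.
Qed.

Lemma gain_le k N gam (B : 'M[F]_(k, n)) i :
  row_free B -> (N <= D)%N -> (gain N gam B i <= 'C(k + N, k))%N.
Proof.
move=> rB ND; apply: leq_trans (sum_gain_le gam (pts i) rB ND).
by rewrite (bigD1 i) /= ?leq_addr // subrr sub0mx.
Qed.

(** Larger handicaps at the other points relax the conditions imposed before those at [pts i], and a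
    larger degree bound enlarges the space: the stages can only grow. *)
Lemma gain_mono k N N' gam gam' (B : 'M[F]_(k, n)) i :
  (N <= N')%N -> (forall q, gam q <= gam' q)%N -> gam' i = gam i ->
  (gain N gam B i <= gain N' gam' B i)%N.
Proof.
move=> NN gg gi; apply: leq_sum => r _; apply: codim_sub.
apply: subv_trans (addvSl _ _); apply/subvP => v /mem_stage[vN h].
apply/mem_stage; split=> [a Na|q qB]; first by rewrite vN // (leq_ltn_trans NN).
by apply: vord_le (h q qB); rewrite /threshold gi; have := gg q; lia.
Qed.

(** When [pts i] has its first turn, the order required at [pts q] already exceeds [N], so the
    polynomials left vanish on the plane containing both points. *)
Lemma gain_eq0 k N gam (B : 'M[F]_(k, n)) (i q : 'I_m) :
  (pts q - pts i <= B)%MS -> (N + gam q < gam i)%N -> gain N gam B i = 0%N.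
Proof.
move=> qB Ng; rewrite /gain big1 // => r _; apply: codim0; apply/subvP => v.
move=> /mem_stage[vN /(_ q qB) vq]; apply/mem_ordsp.
suff -> : restr (pts i) B (topoly v) = 0 by move=> a _; rewrite mcoeff0.
apply: (@restr_translate _ _ _ (pts q)); first by rewrite -opprB eqmx_opp.
apply: (degle_vord_eq0 (degle_restr _ _ vN)); apply: vord_le vq.
by rewrite /threshold; lia.
Qed.
End Configuration.

(** * The effect of one demotion on the gain *)

Section Lipschitz.
Variables (F : fieldType) (n D m : nat) (pts : 'I_m -> 'rV[F]_n).
Hypothesis pts_inj : injective pts.

(** A product with one factor per point: for [q != i], a coordinate that separates [pts q] from
    [pts i], minus its value at [pts q]; for [q = i], the constant 1. This works over every field,
    however small. *)
Lemma separating_poly (i : 'I_m) : exists f : mpoly n F,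
  [/\ degle m f, forall q, q != i -> vord 1 (restr (pts q) 1%:M f)
    & mcoeff (@mnm0 n) (restr (pts i) 1%:M f) != 0].
Proof.
have sep q : exists l : mpoly n F,
    [/\ degle 1 l, q != i -> vord 1 (restr (pts q) 1%:M l)
      & mcoeff (@mnm0 n) (restr (pts i) 1%:M l) != 0].
  have [qi|qi] := eqVneq q i.
    exists 1; split=> [a a1||]; first by apply: degle1; apply: ltn_trans a1.
      by [].
    by rewrite rmorph1 mcoeff1 eqxx oner_neq0.
  have [s qs] : exists s, pts i 0 s != pts q 0 s.
    apply/existsP; apply: contraNT qi => /existsPn h; apply/eqP/pts_inj/rowP => s.
    by apply/esym/eqP; have := h s; rewrite negbK.
  exists (mpolyX F (mnm1 s) - mpolyC n (pts q 0 s)); split=> [a a1|_ a|].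
  - rewrite mcoeffB mcoeffX mcoeffC -mdeg_eq0 gtn_eqF ?(ltn_trans _ a1) //.
    by rewrite mulr0 subr0; case: eqP a1 => // <-; rewrite mdeg1.
  - rewrite ltnS leqn0 mdeg_eq0 => /eqP ->.
    rewrite rmorphB /= restr1_X restrC addrAC subrr add0r mcoeffX.
    by rewrite mnm1_eq0.
  rewrite rmorphB /= restr1_X restrC mcoeffB mcoeffD !mcoeffC mcoeffX eqxx.
  by rewrite mnm1_eq0 !mulr1 addr0 subr_eq0.
have [l lP] := fin_all_exists sep.
have big : forall s : seq 'I_m, [/\ degle (size s) (\prod_(q <- s) l q),
    forall q, q \in s -> q != i -> vord 1 (restr (pts q) 1%:M (\prod_(q <- s) l q))
    & mcoeff (@mnm0 n) (restr (pts i) 1%:M (\prod_(q <- s) l q)) != 0].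
  elim=> [|q s [IH1 IH2 IH3]].
    by rewrite big_nil; split=> //; [exact: degle1 | rewrite rmorph1 mcoeff1 eqxx oner_neq0].
  have [lq1 lq2 lq3] := lP q; rewrite big_cons; split.
  - by rewrite /= -add1n; apply: degleM.
  - move=> q'; rewrite in_cons => /orP[/eqP -> qi|q's qi]; rewrite rmorphM /=.
      by rewrite -[1%N]addn0; apply: vordM (vord0 _); apply: lq2.
    by rewrite -[1%N]add0n; apply: vordM (vord0 _) _; apply: IH2.
  - by rewrite rmorphM /= rmorphM mulf_neq0.
have [h1 h2 h3] := big (enum 'I_m); exists (\prod_(q <- enum 'I_m) l q).
split=> // [|q qi]; first by move: h1; rewrite size_enum_ord.
by apply: h2; rewrite ?mem_enum.
Qed.

(* Multiplication by a separating polynomial raises the orders of vanishing at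
   the other points, at the cost of a larger degree, and only rescales the
   lowest-order part at [pts i]. *)
Lemma gain_raise_degree k N gam gam' (B : 'M[F]_(k, n)) (i : 'I_m) :
  (forall q, gam' q = gam q + (q == i))%N -> (N + m <= D)%N ->
  (gain D pts N gam B i <= gain D pts (N + m) gam' B i)%N.
Proof.
move=> gE ND; have [f [fm fq fi]] := separating_poly i.
apply: leq_sum => r _; apply: codim_sub; apply/subvP => v /mem_stage[vN h].
set c := mcoeff _ _ in fi; pose g := f * topoly v; pose u := ofpoly D g.
have gN : degle (N + m) g by rewrite addnC; apply: degleM.
have uE : topoly u = g by apply: ofpolyK gN ND.
(* [u] belongs to the new stage, while [c v - u] is [c - f] times [v] and vanishes at [pts i] to one
   order more than required of [v]. *)
have -> : v = c^-1 *: u + c^-1 *: (c *: v - u).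
  by rewrite -scalerDr addrC subrK scalerA mulVf ?scale1r.
apply: memv_add; apply: memvZ.
  apply/mem_stage; rewrite uE; split=> // q qB; rewrite rmorphM /=.
  have [qi|qi] := eqVneq q i.
    subst q; rewrite -[threshold _ _ _ _]add0n; apply: vordM; first exact: vord0.
    by apply: vord_le (h i qB); rewrite /threshold gE eqxx; lia.
  (* The turns of [pts i] come one round later under [gam'], so one more order is asked at the other
     points; the zero of [f] at [pts q] supplies it. *)
  apply: (@vord_le _ _ _ (1 + threshold gam (r + gam i) i q)).
    by rewrite /threshold !gE eqxx (negbTE qi); lia.
  by apply: vordM (h q qB); apply/vord_restr1/fq.
apply/mem_ordsp; rewrite raddfB /= linearZ /= uE raddfB /= linearZ /= rmorphM /=.
rewrite -mul_mpolyC -mulrBl -add1n; apply: vordM; last first.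
  by apply: vord_le (h i _); rewrite ?subrr ?sub0mx // /threshold; lia.
have cE : mcoeff (@mnm0 k) (restr (pts i) B f) = c.
  have := restr_comp (pts i) 1%:M 0 B f; rewrite mul0mx addr0 mulmx1 => <-.
  set f' := restr (pts i) 1%:M f.
  have : vord 1 (f' - mpolyC n c).
    move=> a; rewrite ltnS leqn0 mdeg_eq0 => /eqP ->.
    by rewrite mcoeffB mcoeffC eqxx mulr1 subrr.
  move=> /(vord_restr B)/(_ (@mnm0 k)); rewrite mdeg0 => /(_ isT).
  by rewrite raddfB /= restrC mcoeffB mcoeffC eqxx mulr1 => /eqP; rewrite subr_eq0 => /eqP.
move=> a; rewrite ltnS leqn0 mdeg_eq0 => /eqP ->.
by rewrite mcoeffB mcoeffC eqxx mulr1 cE subrr.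
Qed.

(* By [gain_raise_degree], the loss is at most what the gain at [pts i] can win
   from the larger degree, hence at most what the total gain wins. *)
Lemma gain_lipschitz k N gam gam' (B : 'M[F]_(k, n)) (i : 'I_m) :
  row_free B ->
  (forall q, gam' q = gam q + (q == i))%N -> (N + m <= D)%N ->
  (gain D pts N gam B i + 'C(k + N, k)
    <= gain D pts N gam' B i + 'C(k + (N + m), k))%N.
Proof.
move=> rB gE ND; have ND' : (N <= D)%N by apply: leq_trans ND; apply: leq_addr.
have iB : ((pts i - pts i)%R <= B)%MS by rewrite subrr sub0mx.
rewrite -(sum_gain gam' rB ND' iB) -(sum_gain gam' rB ND iB).
rewrite (bigD1 i) //= [X in (_ <= _ + X)%N](bigD1 i) //=.
have h1 := gain_raise_degree B gE ND.
have h2 : (\sum_(q < m | ((pts q - pts i)%R <= B)%MS && (q != i))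
      gain D pts N gam' B q <=
    \sum_(q < m | ((pts q - pts i)%R <= B)%MS && (q != i))
      gain D pts (N + m) gam' B q)%N.
  by apply: leq_sum => q _; apply: gain_mono => //; apply: leq_addr.
by rewrite addnCA leq_add2l; apply: leq_add.
Qed.
End Lipschitz.

(** * The lower bound for products of gains over transversal planes *)

Section Transversal.
Variables (F : fieldType) (n D m : nat) (pts : 'I_m -> 'rV[F]_n).

(** Given the earlier conditions, the new ones at order [r] concern the coefficients of degree [r].
    [pivot] picks as many of these as the codimension, and the union over [r] is no larger than the
    gain. *)
Lemma pivot_monomials k N gam (B : 'M[F]_(k, n)) (i : 'I_m) :
  exists S : {set bmultinom k D.+1}, (#|S| <= gain D pts N gam B i)%N /\
    forall r (v : psp F n D), v \in stage D pts N gam (pts i) B (r + gam i) i ->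
      (forall a : bmultinom k D.+1, a \in S -> mdeg a = r ->
         mcoeff a (restr (pts i) B (topoly v)) = 0) ->
      vord r.+1 (restr (pts i) B (topoly v)).
Proof.
have iB : ((pts i - pts i)%R <= B)%MS by rewrite subrr sub0mx.
have stage_ord r (v : psp F n D) :
    v \in stage D pts N gam (pts i) B (r + gam i) i ->
    vord r (restr (pts i) B (topoly v)).
  by case/mem_stage => _ /(_ i iB); rewrite /threshold ltnn addn0 addnK.
have zeroE (v : psp F n D) : (0 : 'Hom(psp F n D, F^o)) v = 0.
  exact: zero_lfunE.
pose phi r (a : bmultinom k D.+1) : 'Hom(psp F n D, F^o) :=
  if mdeg a == r then rcoef D (pts i) B a else 0.
have pivS (r : 'I_D.+1) : exists S : {set bmultinom k D.+1},
    (#|S| <= codim (stage D pts N gam (pts i) B (r + gam i) i)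
                   (ordsp D (pts i) B r.+1))%N /\
    forall v, v \in stage D pts N gam (pts i) B (r + gam i) i ->
      (forall a, a \in S -> phi r a v = 0) -> v \in ordsp D (pts i) B r.+1.
  apply: pivot => [a|v vs v0].
    apply/subvP => v /mem_ordsp vr; rewrite memv_ker /phi.
    case: (mdeg a =P r) => ar; last by rewrite zeroE.
    by rewrite rcoefE vr // ar.
  apply/mem_ordsp => a; rewrite ltnS leq_eqVlt => /orP[/eqP ar|]; last first.
    exact: stage_ord.
  have aD : (mdeg a < D.+1)%N by rewrite ar.
  by have := v0 (BMultinom aD); rewrite /phi /= ar eqxx rcoefE.
have [S SP] := fin_all_exists pivS.
exists (\bigcup_r S r); split.
  apply: (@leq_trans (\sum_(r < D.+1) #|S r|)); last first.
    by apply: leq_sum => r _; case: (SP r).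
  apply: (big_ind2 (fun (A : {set bmultinom k D.+1}) e => #|A| <= e)%N) => //.
    by rewrite cards0.
  move=> A a B' b Aa Bb; apply: leq_trans (leq_add Aa Bb).
  by rewrite -cardsUI leq_addr.
(* The union stops at order [D]; beyond it the restriction is already zero. *)
move=> r v vs v0; have [Dr|rD] := ltnP D r.
  have /eqP z : restr (pts i) B (topoly v) == 0.
    apply/eqP/(degle_vord_eq0 (N := D)); first exact/degle_restr/degle_topoly.
    exact: vord_le (stage_ord _ _ vs).
  by rewrite z => a _; rewrite mcoeff0.
apply/mem_ordsp; have [_] := SP (Ordinal (rD : r < D.+1)%N); apply=> // a aS.
rewrite /phi /=; case: (mdeg a =P r) => ar; last exact: zeroE.
by rewrite rcoefE v0 //; apply/finset.bigcupP; exists (Ordinal (rD : r < D.+1)%N).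
Qed.

Variables (d : nat) (k : 'I_d -> nat) (iota : forall j, 'I_(k j) -> 'I_n).
Hypothesis iota_inj : forall j, injective (@iota j).
Hypothesis iota_disj : forall j j' x y, @iota j x = @iota j' y -> j = j'.
Hypothesis iota_cover : forall s, exists j x, @iota j x = s.

Lemma monomial_eq (a b : multinom n) :
  (forall j, mback (@iota j) a = mback (@iota j) b) -> a = b.
Proof.
move=> ab; apply/mnmP => s; have [j [x <-]] := iota_cover s.
by have := congr1 (fun c : multinom (k j) => c x) (ab j); rewrite !mnmE.
Qed.

Lemma mdeg_mback j (a : multinom n) : (mdeg (mback (@iota j) a) <= mdeg a)%N.
Proof.
rewrite -[X in (_ <= mdeg X)%N](mback_rest (@iota_inj j)) mdegD mdeg_mrange //.
exact: leq_addr.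
Qed.

Variables (N : nat) (gam : 'I_m -> nat).
Hypothesis ND : (N <= D)%N.
Variables (B : 'I_m -> forall j, 'M[F]_(k j, n)) (M : 'I_m -> 'M[F]_n).
Hypothesis B_free : forall i j, row_free (B i j).
Hypothesis M_unit : forall i, M i \in unitmx.
Hypothesis MB : forall i j, incl_mx F (@iota j) *m M i = B i j.

(* [S i j] indexes enough coefficients to detect, among the polynomials passing
   the earlier conditions, those passing the next one at [pts i]. *)
Definition pivoting (S : forall i j, {set bmultinom (k j) D.+1}) :=
  forall i j r (v : psp F n D),
    v \in stage D pts N gam (pts i) (B i j) (r + gam i) i ->
    (forall a : bmultinom (k j) D.+1, a \in S i j -> mdeg a = r ->
       mcoeff a (restr (pts i) (B i j) (topoly v)) = 0) ->
    vord r.+1 (restr (pts i) (B i j) (topoly v)).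

Definition selected (S : forall i j, {set bmultinom (k j) D.+1}) (i : 'I_m) j
    (a : multinom n) :=
  exists2 b : bmultinom (k j) D.+1, b \in S i j & bmnm b = mback (@iota j) a.

(* The blocks of the monomial [a] are freed one at a time from being selected:
   the coefficients of [a] with its [j]-th block varying are those of a
   polynomial on the plane of direction [B i j], to which [pivoting] applies. *)
Lemma vord_step S (i : 'I_m) r g : pivoting S -> degle N g ->
  (forall a, (forall j, selected S i j a) -> mcoeff a (restr (pts i) (M i) g) = 0) ->
  (forall q, vord (threshold gam (r + gam i) i q) (restr (pts q) 1%:M g)) ->
  vord r.+1 (restr (pts i) (M i) g).
Proof.
move=> SP gN g0 gv; pose G := restr (pts i) (M i) g.
have Gr : vord r G.
  by apply/vord_restr1; have := gv i; rewrite /threshold ltnn addn0 addnK.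
(* The blocks before [e] are arbitrary, those from [e] on are selected; at [e = d] no assumption is
   left. *)
suff G0 e a : mdeg a = r ->
    (forall j : 'I_d, (e <= j)%N -> selected S i j a) -> mcoeff a G = 0.
  move=> a; rewrite ltnS leq_eqVlt => /orP[/eqP ar|]; last exact: Gr.
  by apply: (G0 d a ar) => j; rewrite leqNgt ltn_ord.
elim: e a => [|e IH] a ar aS; first by apply: g0 => j; apply: aS.
have [ed|de] := ltnP e d; last first.
  by apply: IH => // j ej; have := ltn_ord j; lia.
pose j := Ordinal ed; pose io := @iota j.
have io_inj : injective io := @iota_inj j.
pose h := extract io a G; pose P := pinvmx (B i j).
have hN : degle N h by apply/degle_extract/degle_restr.
(* [h] lives in the coordinates of the plane; [w] extends it to the whole space, where the stages
   are defined. *)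
pose w := restr (- (pts i *m P)) P h; pose v := ofpoly D w.
have vE : topoly v = w by apply: ofpolyK ND; apply: degle_restr.
have wE y : restr (pts i + y *m B i j) (B i j) w = restr y 1%:M h.
  by rewrite restr_comp mulmxDl -mulmxA mulmxVp // mulmx1 addrA addNr add0r.
have wi : restr (pts i) (B i j) w = h.
  by rewrite -[in LHS](addr0 (pts i)) -(mul0mx _ (B i j)) wE restr01.
have aE : mdeg a = (mdeg (mback io a) + mdeg (mrest io a))%N.
  by rewrite -{1}(mback_rest io_inj a) mdegD mdeg_mrange.
have -> : mcoeff a G = mcoeff (mback io a) h.
  by rewrite mcoeff_extract // mback_rest.
rewrite -wi -vE; apply: (SP i j (mdeg (mback io a))) => [|b bS bdeg|//].
  apply/mem_stage; rewrite vE; split; first exact: degle_restr.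
  move=> q /submxP[y yq].
  have qE : pts q = pts i + y *m B i j by rewrite -yq addrC subrK.
  (* In the plane, [h] keeps at [pts q] the order of [g] minus the degree of the rest of [a]. This
     loss turns round [r + gam i] into round [mdeg (mback io a) + gam i]. *)
  rewrite [in restr _ _]qE wE restr_extract // restr_comp mul1mx -mulmxA MB -qE.
  apply: vord_le (vord_extract io_inj (vord_restr1 (M i) (gv q))).
  by rewrite /threshold -ar aE; lia.
rewrite vE wi mcoeff_extract //; set a' := mnm_add _ _.
have a'j : mback io a' = b by apply: mback_add.
(* The [j]-th block of [a'] is the selected [b], and its other blocks are those of [a], so the
   blocks from [e] on are all selected. *)
apply: IH => [|j' ej'].
  by rewrite mdegD mdeg_mrange // bdeg -ar aE.
have [jj'|jj'] := eqVneq j' j.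
  by subst j'; exists b.
have [|c cS cE] := aS j'.
  by rewrite ltn_neqAle ej' andbT; apply: contraNneq jj' => ej; apply/eqP/val_inj.
exists c => //; rewrite cE; apply/mnmP => x; rewrite [LHS]mnmE [RHS]mnmE mnmDE.
have nio : ~~ [exists y, io y == iota x].
  apply: contra jj' => /existsP[y /eqP /iota_disj jE]; by rewrite -jE.
by rewrite mrange_out // mnmE (negbTE nio).
Qed.

(** Turn by turn, [vord_step] makes [g] pass every condition in the whole space, until its order at
    one point exceeds its degree. *)
Lemma vanishing S g : (0 < m)%N -> pivoting S -> degle N g ->
  (forall i a, (forall j, selected S i j a) -> mcoeff a (restr (pts i) (M i) g) = 0) ->
  g = 0.
Proof.
move=> m0 SP gN g0.
pose ok tau e := forall q, vord (threshold gam tau e q) (restr (pts q) 1%:M g).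
have okS tau e : (e < m)%N -> ok tau e -> ok tau e.+1.
  move=> em h q; pose i := Ordinal em.
  have [->|qi] := eqVneq q i; last first.
    apply: vord_le (h q); rewrite /threshold.
    have : (q : nat) <> e by move=> qe; case/eqP: qi; apply/val_inj.
    lia.
  have [ti|it] := ltnP tau (gam i).
    apply: (@vord_le _ _ _ 0); last exact: vord0.
    by rewrite /threshold ltnSn addn1 leqn0 subn_eq0.
  have thrE : threshold gam tau e.+1 i = (tau - gam i).+1.
    by rewrite /threshold ltnSn addn1 subSn.
  rewrite thrE; apply: (vord_restr_unit (M_unit i)).
  by apply: vord_step SP gN (g0 i) _ => q'; rewrite subnK.
have ok_all tau e : (e <= m)%N -> ok tau e.
  elim: tau e => [|tau IHtau]; elim=> [|e IHe] em.
  - by move=> q; apply: vord0.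
  - exact/okS/IHe/ltnW.
  - move=> q; apply: vord_le (IHtau m (leqnn _) q).
    by rewrite /threshold ltn_ord ltn0 addn1 addn0.
  - exact/okS/IHe/ltnW.
pose i0 := Ordinal m0.
apply: (@restr1_eq0 _ _ (pts i0)); apply: (degle_vord_eq0 (degle_restr _ _ gN)).
apply: vord_le (ok_all (N.+1 + gam i0)%N 0%N _ i0) => //.
by rewrite /threshold; lia.
Qed.

(** The coefficients at [pts i] of the monomials with all blocks selected determine a polynomial of
    degree at most [N], by [vanishing]. A monomial is determined by its blocks, so at [pts i] there
    are at most as many as the product of the gains. *)
Lemma transversal_gain : (0 < m)%N ->
  ('C(n + N, n) <= \sum_(i < m) \prod_(j < d) gain D pts N gam (B i j) i)%N.
Proof.
move=> m0.
have piv i j := pivot_monomials N gam (B i j) i.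
have [S SP] : exists S : forall i j, {set bmultinom (k j) D.+1},
    (forall i j, #|S i j| <= gain D pts N gam (B i j) i)%N /\ pivoting S.
  have /fin_all_exists[S SP] i : exists S : forall j, {set bmultinom (k j) D.+1},
      forall j, (#|S j| <= gain D pts N gam (B i j) i)%N /\ _ := fin_all_exists (piv i).
  exists S; split=> i j; first by have [] := SP i j.
  by have [_] := SP i j; apply.
have {SP} [Sle SP] := SP.
pose part j (a : bmultinom n D.+1) : bmultinom (k j) D.+1 :=
  BMultinom (leq_ltn_trans (mdeg_mback j a) (bmdeg a)).
pose Gs i : {set bmultinom n D.+1} := [set a | [forall j, part j a \in S i j]].
have card_Gs i : (#|Gs i| <= \prod_(j < d) gain D pts N gam (B i j) i)%N.
  apply: (@leq_trans (\prod_(j < d) #|S i j|)); last by apply: leq_prod => j _.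
  rewrite -cardsXn.
  pose f (a : bmultinom n D.+1) : {dffun forall j, bmultinom (k j) D.+1} :=
    [ffun j => part j a].
  have f_inj : injective f.
    move=> a b ab; apply/val_inj/monomial_eq => j.
    by have := congr1 (fun h : {dffun forall j, bmultinom (k j) D.+1} => bmnm (h j)) ab;
       rewrite !ffunE.
  rewrite -(card_imset _ f_inj); apply/subset_leq_card/fintype.subsetP => h.
  case/imsetP=> a; rewrite inE => /forallP aS ->; apply/setXnP => j.
  by rewrite ffunE; apply: aS.
rewrite -card_bmultinom -(dim_degsp F n ND).
apply: (@leq_trans #|{: {i : 'I_m & {a | a \in Gs i}}}|); last first.
  rewrite card_tagged sumnE big_map big_enum /=; apply: leq_sum => i _.
  rewrite card_sig; apply: leq_trans (card_Gs i); apply/subset_leq_card/fintype.subsetP => a; by rewrite inE.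
apply: (dim_le_functionals
  (phi := fun ia : {i : 'I_m & {a | a \in Gs i}} =>
     rcoef D (pts (tag ia)) (M (tag ia)) (val (tagged ia)))) => v /mem_degsp vN v0.
apply: topoly_eq0; apply: (vanishing m0 SP vN) => i a aS.
have [Da|aD] := ltnP D (mdeg a); first by apply/degle_restr/Da/degle_topoly.
pose a' : bmultinom n D.+1 := BMultinom (aD : mdeg a < D.+1)%N.
have aG : a' \in Gs i.
  rewrite inE; apply/forallP => j; have [b bS ba] := aS j.
  by rewrite (_ : part j a' = b) //; apply/val_inj.
by have := v0 (Tagged (fun i => {a | a \in Gs i}) (exist _ a' aG)); rewrite rcoefE.
Qed.
End Transversal.

Local Open Scope classical_set_scope.
Local Open Scope ring_scope.

(** * Inequalities for binomial coefficients and products *)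

Lemma prod_ffact_le d (k : 'I_d -> nat) N :
  (\prod_(j < d) (k j + N) ^_ (k j) <=
    (\sum_(j < d) k j + N) ^_ (\sum_(j < d) k j))%N.
Proof.
have ffactM a b : ((a + N) ^_ a * (b + N) ^_ b <= (a + b + N) ^_ (a + b))%N.
  elim: a => [|a IH]; first by rewrite ffactn0 mul1n add0n.
  by rewrite !addSn !ffactSS -mulnA leq_mul //; lia.
apply: (big_rec2 (fun a s => a <= (s + N) ^_ s)%N) => [|j a s _ IH]; first by rewrite ffactn0.
by apply: leq_trans (ffactM _ _); rewrite leq_mul2l IH orbT.
Qed.

(** Compares the dimensions on the planes with that on the whole space, uniformly in [N]; the
    factorial in the final constant comes from here. *)
Lemma prod_bin_le d (k : 'I_d -> nat) N n : (\sum_(j < d) k j)%N = n ->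
  (\prod_(j < d) 'C(k j + N, k j) <= n`! * 'C(n + N, n))%N.
Proof.
move=> kn; rewrite mulnC bin_ffact -kn.
apply: leq_trans (prod_ffact_le k N); apply: leq_prod => j _.
by rewrite -bin_ffact leq_pmulr // fact_gt0.
Qed.

(** Each of the [k] factors of the falling factorial grows by a ratio of at most [L.+1 / L]. *)
Lemma bin_shift_le k m L :
  (L ^ k * 'C(k + (m * L + m), k) <= L.+1 ^ k * 'C(k + m * L, k))%N.
Proof.
rewrite -(leq_pmul2r (fact_gt0 k)) -!mulnA !bin_ffact.
elim: k => [|k IH]; first by rewrite !ffactn0.
rewrite !addSn !ffactSS !expnS.
rewrite -[X in (X <= _)%N]mulnACA -[X in (_ <= X)%N]mulnACA leq_mul //.
by rewrite !mulnS !mulSn; lia.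
Qed.

Lemma expnS_le L n : (0 < L)%N -> (L * L.+1 ^ n <= (L + 2 ^ n) * L ^ n)%N.
Proof.
(* The induction needs the sharper constant [c = 2 ^ n - 1], which passes to [2 c + 1]. *)
move=> L0; suff: (L * L.+1 ^ n <= (L + (2 ^ n).-1) * L ^ n)%N.
  by move=> h; apply: leq_trans h _; rewrite leq_mul2r leq_add2l leq_pred orbT.
elim: n => [|n IH]; first by rewrite !expn0 addn0.
have e2 : (2 ^ n.+1).-1 = (2 ^ n).-1.*2.+1.
  by rewrite expnS; have := expn_gt0 2 n; lia.
rewrite e2 !expnS; set c := (2 ^ n).-1 in IH *.
rewrite mulnCA; apply: (@leq_trans (L.+1 * ((L + c) * L ^ n))).
  by rewrite leq_mul2l IH.
rewrite !mulnA leq_mul2r; apply/orP; right; nia.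
Qed.

Lemma prod_bin_shift d (k : 'I_d -> nat) n m L : (0 < L)%N ->
  (\sum_(j < d) k j)%N = n ->
  (L * \prod_(j < d) 'C(k j + (m * L + m), k j) <=
   (L + 2 ^ n) * \prod_(j < d) 'C(k j + m * L, k j))%N.
Proof.
move=> L0 kn; have Ln : (0 < L ^ n)%N by rewrite expn_gt0 L0.
rewrite -(leq_pmul2l Ln) mulnCA [X in (_ <= X)%N]mulnCA.
have pr (x : nat) : (x ^ n = \prod_(j < d) x ^ k j)%N.
  by rewrite -kn expn_sum.
apply: (@leq_trans (L * (L.+1 ^ n * \prod_(j < d) 'C(k j + m * L, k j))))%N.
  rewrite leq_mul2l !pr -!big_split; apply/orP; right; apply: leq_prod => j _.
  exact: bin_shift_le.
by rewrite !mulnA leq_mul2r expnS_le ?orbT.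
Qed.

(** With [e = p' - p], each [a] is at most [b + e]. The increase from the product of the [b] to that
    of the [b + e] grows with [b], hence is largest at [b = p]. *)
Lemma prod_slack d (a b p p' : 'I_d -> nat) :
  (forall j, a j + p j <= b j + p' j)%N -> (forall j, b j <= p j)%N ->
  (forall j, p j <= p' j)%N ->
  (\prod_(j < d) a j + \prod_(j < d) p j <=
    \prod_(j < d) b j + \prod_(j < d) p' j)%N.
Proof.
move=> ab bp pp.
suff [] : [/\ (\prod_(j < d) a j + \prod_(j < d) p j <=
    \prod_(j < d) b j + \prod_(j < d) p' j)%N,
    (\prod_(j < d) b j <= \prod_(j < d) p j)%N
   & (\prod_(j < d) p j <= \prod_(j < d) p' j)%N] by [].
elim: d a b p p' ab bp pp => [|d IH] a b p p' ab bp pp; first by rewrite !big_ord0.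
have [] := IH (fun j => a (lift ord0 j)) (fun j => b (lift ord0 j))
  (fun j => p (lift ord0 j)) (fun j => p' (lift ord0 j)) => //.
rewrite !big_ord_recl.
move: (ab ord0) (bp ord0) (pp ord0) => h1 h2 h3 h4 h5 h6.
split; [|exact: leq_mul|exact: leq_mul].
move: h1 h2 h3 h4 h5 h6; move: (a ord0) (b ord0) (p ord0) (p' ord0).
move: (\prod_(i < d) a _)%N (\prod_(i < d) b _)%N (\prod_(i < d) p _)%N
  (\prod_(i < d) p' _)%N => A B P P' x y z t.
move=> h1 h2 h3 h4 h5 h6.
have [e te] : exists e, t = (z + e)%N by exists (t - z)%N; lia.
have [E PE] : exists E, P' = (P + E)%N by exists (P' - P)%N; lia.
subst t P'; have xy : (x <= y + e)%N by lia.
have AB : (A <= B + E)%N by lia.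
have := leq_mul xy AB.
have u1 : (y * E <= z * E)%N by rewrite leq_mul2r h2 orbT.
have u2 : (e * B <= e * P)%N by rewrite leq_mul2l h5 orbT.
rewrite !mulnDl !mulnDr; lia.
Qed.

(** * Balancing handicaps, for abstract gains *)

Section Equilibrium.
Variables (R : realFieldType) (m N : nat) (X : Type).
Variables (G : ('I_m -> nat) -> 'I_m -> X -> nat) (M sl : nat) (w : 'I_m -> R).
Hypothesis M_gt0 : (0 < M)%N.
Hypothesis w_gt0 : forall i, 0 < w i.
Hypothesis w_sum : \sum_i w i = 1.
Hypothesis sl_small : forall i, (m * sl)%:R <= w i * M%:R / 2.

Definition raise (gam : 'I_m -> nat) (i q : 'I_m) := (gam q + (q == i))%N.

Hypothesis G_total : forall gam (x : 'I_m -> X), (M <= \sum_i G gam i (x i))%N.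
Hypothesis G_other : forall gam i q x, q != i -> (G gam q x <= G (raise gam i) q x)%N.
Hypothesis G_self : forall gam i x, (G gam i x <= G (raise gam i) i x + sl)%N.
Hypothesis G_far : forall gam i q, q != i -> (N + gam q < gam i)%N ->
  exists x, G gam i x = 0%N.

(* Only points with a large gain are ever demoted, so a demoted point keeps at
   least its share; [G_far] keeps the handicaps bounded as long as one point
   has never been demoted. *)
Lemma equilibrium : exists gam, forall i x, w i * M%:R / 2 <= (G gam i x)%:R.
Proof.
apply: contrapT => none.
have poor gam : exists i x, (G gam i x)%:R < w i * M%:R / 2.
  apply: contrapT => h; apply: none; exists gam => i x; rewrite leNgt.
  by apply/negP => lt; apply: h; exists i, x.
pose inv gam := forall i, (0 < gam i)%N -> forall x, w i * M%:R <= (G gam i x)%:R.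
have wM i : 0 < w i * M%:R by rewrite mulr_gt0 // ltr0n.
have run t : exists gam, inv gam /\ (\sum_i gam i = t)%N.
  elim: t => [|t [gam [ginv gt]]].
    by exists (fun=> 0%N); split=> //; rewrite big1.
  have [i0 [x0 px0]] := poor gam.
  have [i rich] : exists i, forall x, w i * M%:R + sl%:R <= (G gam i x)%:R.
    apply: contrapT => h.
    have /fin_all_exists[x px] i : exists x, (G gam i x)%:R < w i * M%:R + sl%:R.
      apply: contrapT => hi; apply: h; exists i => x; rewrite leNgt.
      by apply/negP => lt; apply: hi; exists x.
    pose y i := if i == i0 then x0 else x i.
    (* Without a rich point the total would stay below [M]: the poor point [i0] misses at least half
       of its share, which covers the slack [sl] of all the others. *)
    have : (M%:R : R) <= \sum_i (G gam i (y i))%:R.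
      by rewrite -natr_sum ler_nat; apply: G_total.
    rewrite leNgt => /negP; apply.
    rewrite (bigD1 i0) //= /y eqxx.
    apply: (@lt_le_trans _ _ (w i0 * M%:R / 2 + \sum_(i | i != i0) (w i * M%:R + sl%:R))).
      apply: ltr_leD => //; apply: ler_sum => i /negbTE ->; exact/ltW.
    rewrite big_split /= -mulr_suml.
    have -> : \sum_(i | i != i0) w i = 1 - w i0.
      by rewrite -w_sum [in RHS](bigD1 i0) //= addrAC subrr add0r.
    have : \sum_(i | i != i0) (sl%:R : R) <= (m * sl)%:R.
      rewrite -natr_sum ler_nat sum_nat_const leq_mul2r; apply/orP; right.
      by rewrite -[X in (_ <= X)%N](card_ord m) max_card.
    have := sl_small i0; nra.
  exists (raise gam i); split; last first.
    rewrite /raise big_split /= gt (bigD1 i) //= eqxx big1 ?addn0 ?addn1 // => q.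
    by move/negbTE ->.
  move=> q; rewrite /raise; have [->|qi] := eqVneq q i => gq x.
    have := rich x; have : ((G gam i x)%:R : R) <= (G (raise gam i) i x)%:R + sl%:R.
      by rewrite -natrD ler_nat.
    by rewrite /raise; lra.
  rewrite addn0 in gq; apply: le_trans (ginv q gq x) _.
  by rewrite ler_nat; apply: G_other.
(* One demotion more than [m] handicaps bounded by [N] can hold; the bound comes from comparison
   with [i0], which is poor and hence was never demoted. *)
have [gam [ginv gs]] := run (m * N).+1.
have [i0 [x0 px0]] := poor gam.
have gi0 : gam i0 = 0%N.
  apply/eqP; rewrite -leqn0 leqNgt; apply/negP => /ginv/(_ x0).
  by have := wM i0; lra.
suff : (\sum_i gam i <= m * N)%N by rewrite gs ltnn.
have -> : (m * N = \sum_(i < m) N)%N by rewrite sum_nat_const card_ord.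
apply: leq_sum => i _; have [->|ii0] := eqVneq i i0; first by rewrite gi0.
rewrite leqNgt; apply/negP => Ni.
have [||x Gx] := @G_far gam i i0; [by rewrite eq_sym | by rewrite gi0 addn0 |].
have := ginv i (leq_ltn_trans (leq0n _) Ni) x; rewrite Gx.
by have := wM i; lra.
Qed.
End Equilibrium.

(** * Frames adapted to a transversal family of planes *)

Section Blocks.
Variables (F : fieldType) (n d : nat) (k : 'I_d -> nat).
Hypothesis kn : (\sum_(j < d) k j)%N = n.

Definition block j (x : 'I_(k j)) : 'I_n := cast_ord kn (tagnat.Rank j x).

Lemma block_inj j : injective (@block j).
Proof.
move=> x y /cast_ord_inj xy; apply/val_inj/eqP.
by have /eqP := congr1 val xy; rewrite tagnat.eq_Rank => /andP[].
Qed.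

Lemma block_disj j j' (x : 'I_(k j)) (y : 'I_(k j')) : block x = block y -> j = j'.
Proof.
move=> /cast_ord_inj xy.
by have /eqP := congr1 val xy; rewrite tagnat.eq_Rank => /andP[/eqP].
Qed.

Lemma block_cover s : exists j (x : 'I_(k j)), block x = s.
Proof.
exists (tagnat.sig1 (cast_ord (esym kn) s)), (tagnat.sig2 (cast_ord (esym kn) s)).
by rewrite /block tagnat.sig2K cast_ordKV.
Qed.

Definition block_mx j : 'M[F]_(k j, n) := incl_mx F (@block j).

Lemma block_mx0 j j' : j != j' -> block_mx j *m (block_mx j')^T = 0.
Proof.
move=> jj; apply/matrixP => x y; rewrite !mxE big1 // => s _; rewrite !mxE.
case: eqP => [xs|]; last by rewrite mul0r.
case: eqP => [ys|]; last by rewrite mulr0.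
by case/eqP: jj; apply: (block_disj (x := x) (y := y)); rewrite xs ys.
Qed.

Definition stack (B : forall j, 'M[F]_(k j, n)) : 'M[F]_n :=
  \sum_j (block_mx j)^T *m B j.

Lemma block_stack (B : forall j, 'M[F]_(k j, n)) j : block_mx j *m stack B = B j.
Proof.
rewrite /stack mulmx_sumr (bigD1 j) //= mulmxA incl_mxK ?mul1mx; last exact: block_inj.
by rewrite big1 ?addr0 // => j' jj; rewrite mulmxA block_mx0 ?mul0mx // eq_sym.
Qed.

Lemma stack_unit (B : forall j, 'M[F]_(k j, n)) (V : 'I_d -> {vspace 'rV[F]_n}) :
  (forall j v, (v \in V j) = (v <= B j)%MS) -> wedge V -> stack B \in unitmx.
Proof.
move=> VB /eqP VT; rewrite -row_full_unit -sub1mx; apply/row_subP => s.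
set v := row s _; have : v \in fullv by exact: memvf.
rewrite -VT => /memv_sumP[u uV ->]; apply: summx_sub => j _.
have := uV j isT; rewrite VB -block_stack => /submx_trans; apply; exact: submxMl.
Qed.

Lemma block_free (M : 'M[F]_n) j : M \in unitmx -> row_free (block_mx j *m M).
Proof.
move=> uM; rewrite -kermx_eq0; apply/eqP.
have : kermx (block_mx j *m M) *m (block_mx j *m M) *m (invmx M *m (block_mx j)^T) = 0.
  by rewrite mulmx_ker mul0mx.
rewrite -!mulmxA (mulmxA M) mulmxV // mul1mx incl_mxK ?mulmx1 //; exact: block_inj.
Qed.

(** Serves to put two given points on a common plane of a frame. Any nonzero vector can be moved to
    the line of any other: [M] combines the [row_ebase] of [u] with the inverse of that of a
    coordinate vector of block [j]. *)
Lemma exists_frame (u : 'rV[F]_n) j : u != 0 -> (0 < k j)%N ->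
  exists2 M : 'M[F]_n, M \in unitmx & (u <= block_mx j *m M)%MS.
Proof.
move=> u0 kj; pose e : 'rV[F]_n := delta_mx 0 (block (Ordinal kj)).
have e0 : e != 0.
  apply/eqP => /matrixP/(_ 0 (block (Ordinal kj))); rewrite !mxE !eqxx /=.
  by apply/eqP; exact: oner_neq0.
pose M := invmx (row_ebase e) *m row_ebase u; exists M.
  by rewrite unitmx_mul unitmx_inv !row_ebase_unit.
have eb : (e <= block_mx j)%MS.
  apply/submxP; exists (delta_mx 0 (Ordinal kj)); rewrite -rowE.
  by apply/rowP => s; rewrite !mxE eqxx eq_sym.
apply: submx_trans (submxMr M eb).
have re : \rank e = \rank u by rewrite !rank_rV e0 u0.
have eM : e *m M = col_ebase e *m (pid_mx (\rank u) *m row_ebase u).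
  rewrite /M mulmxA mulmxA; congr (_ *m _).
  by rewrite -re -{1}(mulmx_ebase e) mulmxK // row_ebase_unit.
rewrite eM -{1}(mulmx_ebase u) -mulmxA.
have full (v : 'rV[F]_n) : row_full (col_ebase v).
  by rewrite row_full_unit col_ebase_unit.
by rewrite (eqmxMfull _ (full u)) (eqmxMfull _ (full e)).
Qed.
End Blocks.

Lemma Gr_basis (F : fieldType) n k (V : Gr F n k) : exists B : 'M[F]_(k, n),
  row_free B /\ forall v, (v \in val V) = (v <= B)%MS.
Proof.
case: V => V dV /=; move: (dV) => /eqP e; subst k.
pose b := vbasis V; exists (\matrix_i b`_i).
have mulE y : y *m (\matrix_i b`_i) = \sum_i y 0 i *: b`_i.
  by rewrite mulmx_sum_row; apply: eq_bigr => i _; rewrite rowK.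
split; last first.
  move=> v; apply/idP/submxP => [vV|[y ->]].
    exists (\row_i coord b i v); rewrite mulE {1}(coord_vbasis vV).
    by apply: eq_bigr => i _; rewrite mxE.
  rewrite mulE; apply: memv_suml => i _; apply: memvZ; apply: vbasis_mem.
  by rewrite mem_nth // size_tuple.
rewrite -kermx_eq0; apply/rowV0P => y /sub_kermxP; rewrite mulE => y0.
have /freeP bf : free b := basis_free (vbasisP V).
by apply/rowP => i; rewrite mxE; apply: bf.
Qed.

Lemma blocks_gt0 n d (k : 'I_d -> nat) :
  (\sum_(j < d) k j)%N = n -> (0 < n)%N -> (0 < d)%N.
Proof.
by case: d k => // k; rewrite big_ord0 => <-.
Qed.

(** * Existence of balanced handicaps *)

Section Gains.
Variables (F : fieldType) (n d : nat) (k : 'I_d -> nat).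
Hypothesis k_gt0 : forall j, (0 < k j)%N.
Hypothesis kn : (\sum_(j < d) k j)%N = n.
Hypothesis n_gt0 : (0 < n)%N.
Variables (m : nat) (pts : 'I_m -> 'rV[F]_n).
Hypothesis pts_inj : injective pts.
Hypothesis m_gt0 : (0 < m)%N.

(** An invertible matrix encodes a transversal family, its [j]-th block of rows spanning the [j]-th
    plane. The bound [D = N + m] leaves room for a separating polynomial of degree [m]. *)
Definition frame_gain N gam (i : 'I_m) (M : {M : 'M[F]_n | M \in unitmx}) : nat :=
  \prod_(j < d) gain (N + m) pts N gam (block_mx F kn j *m val M) i.

(** [equilibrium] applies: the total comes from [transversal_gain], the slack from [gain_lipschitz]
    and [prod_slack], and a vanishing gain from a frame with a plane through both points. *)
Lemma balanced_handicap (R : realType) (w : 'I_m -> R) :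
  (forall i, 0 < w i) -> \sum_i w i = 1 ->
  exists N gam, forall i M, w i * ('C(n + N, n))%:R / 2 <= (frame_gain N gam i M)%:R.
Proof.
move=> w0 w1.
(* For [N = m L] the slack is at most [2 ^ n * n! / L] times the total ['C(n + N, n)]. Hence
   [L >= 2 K / w i] keeps [m] slacks below half of the share of [i]. *)
pose K := (m * (2 ^ n * n`!))%N.
pose L := (\sum_i Num.bound (2 * K%:R / w i)).+1.
have LK i : 2 * K%:R / w i <= L%:R.
  have K0 : 0 <= 2 * K%:R / w i.
    by apply: divr_ge0; [rewrite mulr_ge0 ?ler0n | exact/ltW].
  have := archi_boundP K0.
  move/ltW/le_trans; apply; rewrite ler_nat /L (bigD1 i) //= -addnS leq_addr //.
pose N := (m * L)%N; exists N.
pose Q N := (\prod_(j < d) 'C(k j + N, k j))%N.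
have Qmono : (Q N <= Q (N + m))%N.
  apply: leq_prod => j _; apply: leq_bin2l; lia.
have slackL : (L * (Q (N + m) - Q N) <= 2 ^ n * (n`! * 'C(n + N, n)))%N.
  have h := prod_bin_shift m (isT : (0 < L)%N) kn.
  have h2 := prod_bin_le N kn.
  apply: (@leq_trans (2 ^ n * Q N)); last by rewrite leq_mul2l h2 orbT.
  by rewrite mulnBr leq_subLR -mulnDl.
apply: (@equilibrium _ _ N _ _ 'C(n + N, n) (Q (N + m)%N - Q N)%N) => //.
- by rewrite bin_gt0 leq_addr.
- move=> i; rewrite ler_pdivlMr // -(ler_pM2l (_ : 0 < L%:R)) ?ltr0n //.
  apply: (@le_trans _ _ (2 * K%:R * ('C(n + N, n))%:R)).
    have : (L * (m * (Q (N + m) - Q N)) * 2 <= 2 * K * 'C(n + N, n))%N.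
      rewrite /K; nia.
    by rewrite -(ler_nat R) !natrM !mulrA.
  rewrite mulrA ler_wpM2r ?ler0n //.
  by have := LK i; rewrite ler_pdivrMr.
- move=> gam M; rewrite /frame_gain.
  apply: (@transversal_gain F n (N + m) m pts d k (@block n d k kn)
     _ _ _ N gam _ (fun i j => block_mx F kn j *m val (M i)) (fun i => val (M i))) => //.
  + exact: block_inj.
  + by move=> j j' x y; apply: block_disj.
  + exact: block_cover.
  + exact: leq_addr.
  + by move=> i j; apply: block_free; apply: (valP (M i)).
  + by move=> i; apply: (valP (M i)).
- move=> gam i q M qi; apply: leq_prod => j _; apply: gain_mono => // [x|].
    exact: leq_addr.
  by rewrite /raise (negbTE qi) addn0.
- move=> gam i M.
  have fr j : row_free (block_mx F kn j *m val M) by apply: block_free; apply: (valP M).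
  have := @prod_slack d (fun j => gain (N + m) pts N gam (block_mx F kn j *m val M) i)
    (fun j => gain (N + m) pts N (raise gam i) (block_mx F kn j *m val M) i)
    (fun j => 'C(k j + N, k j)) (fun j => 'C(k j + (N + m), k j)).
  rewrite /frame_gain -!/(Q _) => H.
  suff : (\prod_(j < d) gain (N + m) pts N gam (block_mx F kn j *m val M) i + Q N <=
    \prod_(j < d) gain (N + m) pts N (raise gam i) (block_mx F kn j *m val M) i +
    Q (N + m)%N)%N.
    by move=> h; rewrite -(leq_add2r (Q N)) -addnA subnK.
  apply: H => j.
  + by apply: gain_lipschitz.
  + by apply: gain_le => //; apply: leq_addr.
  + by apply: leq_bin2l; lia.
move=> gam i q qi far.
have d0 := blocks_gt0 kn n_gt0.
pose j := Ordinal d0.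
have u0 : pts q - pts i != 0 by rewrite subr_eq0 (inj_eq pts_inj).
have [M uM uB] := exists_frame kn u0 (k_gt0 j).
exists (exist _ M uM); rewrite /frame_gain (bigD1 j) //=.
by rewrite (gain_eq0 _ uB far) mul0n.
Qed.
End Gains.

(** * Sums over the support, and the conclusion *)

Lemma esum_sum_at (R : realType) (T : choiceType) m (pts : 'I_m -> T)
    (P : set T) (c : 'I_m -> R) : (forall i, 0 <= c i) ->
  (\esum_(p in P) (\sum_(i < m) (p == pts i)%:R * c i)%:E
   = (\sum_(i < m | pts i \in P) c i)%:E)%E.
Proof.
move=> c0; under eq_esum => p _ do rewrite -sumEFin.
rewrite esum_sum => [|p i _ _]; last by rewrite lee_fin mulr_ge0 ?ler0n.
rewrite [in RHS]big_mkcond -sumEFin; apply: eq_bigr => i _.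
transitivity (\esum_(p in P) if p \in [set pts i] then (c i)%:E else 0)%E.
  apply: eq_esum => p _; have [->|pi] := eqVneq p (pts i).
    by rewrite mem_set ?mul1r.
  by rewrite memNset ?mul0r //= => /eqP; rewrite (negbTE pi).
rewrite -esum_mkcondr; case: ifPn => iP.
  rewrite (_ : _ `&` _ = [set pts i]) ?esum_set1 ?lee_fin //.
  by apply/setIidPr => p ->; rewrite inE in iP.
rewrite (_ : _ `&` _ = set0) ?esum_set0 //.
by apply/seteqP; split=> // p [Pp pE]; case/negP: iP; rewrite inE -pE.
Qed.

Lemma dnorm_eq1 (R : realType) (T : choiceType) d (S : T -> R) (r : seq T) :
  (0 < d)%N -> (forall p, 0 <= S p) -> uniq r -> (forall p, p \notin r -> S p = 0) ->
  dnorm d S = 1 -> \sum_(p <- r) S p ^+ d = 1.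
Proof.
move=> d0 S0 ur rS; rewrite /dnorm (fsbigE r) //; first last.
  by move=> p _ /rS ->; rewrite expr0n gtn_eqF.
rewrite (eq_bigl xpredT) => [|p]; last by rewrite in_setT.
move/eqP; rewrite powR_eq1 invr_eq0 pnatr_eq0 (gtn_eqF d0) orbF.
(* A power with negative base has the default value 1; the sum being nonnegative excludes this
   case. *)
case/orP => [/eqP //|]; rewrite ltNge sumr_ge0 // => p _; exact: exprn_ge0.
Qed.

Theorem theorem1 (R : realType) (n : nat) (hn : (1 <= n)%N) :
  exists C : R,
    forall (F : fieldType) (d : nat) (k : 'I_d -> nat),
      (forall j, (1 <= k j)%N) ->
      (\sum_(j < d) k j)%N = n ->
      forall S : 'rV[F]_n -> R,
        (forall p, 0 <= S p) ->
        finite_set [set p | S p != 0] ->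
        dnorm d S = 1 ->
        exists s : forall m : nat, 'rV[F]_n -> Gr F n m -> R,
          [/\ forall (j : 'I_d) (p : 'rV[F]_n) (V : Gr F n (k j)),
                0 <= s (k j) p V,
              forall (p : 'rV[F]_n) (V : forall j : 'I_d, Gr F n (k j)),
                (wedge (fun j => val (V j)))%:R * S p ^+ d
                  <= C * \prod_(j < d) s (k j) p (V j)
            & forall (j : 'I_d) (P : affine_plane F n (k j)),
                (\esum_(p in P) (s (k j) p (edir P))%:E <= 1)%E].
Proof.
(* The 2 makes up for the half in [balanced_handicap], and the factorial is that of
   [prod_bin_le]. *)
exists (2 * n`!%:R) => F d k k0 kn S S0 fS S1.
have d0 := blocks_gt0 kn hn.
have /finite_seqP[r0 r0E] := fS; pose r := undup r0.
have ur : uniq r := undup_uniq _.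
have rE p : (p \in r) = (S p != 0).
  by rewrite mem_undup; apply/idP/idP => [pr|]; have /seteqP[h1 h2] := r0E;
     [apply: h2 | apply: h1].
have Sr : \sum_(p <- r) S p ^+ d = 1.
  by apply: dnorm_eq1 => // p; rewrite rE negbK => /eqP.
pose m := size r; pose pts (i : 'I_m) : 'rV[F]_n := nth 0 r i.
have pts_inj : injective pts.
  by move=> i i' /eqP; rewrite nth_uniq // => /eqP /val_inj.
have ptsr i : pts i \in r by apply: mem_nth.
pose w (i : 'I_m) := S (pts i) ^+ d.
have w1 : \sum_i w i = 1 by rewrite -Sr (big_nth 0) big_mkord.
have w0 i : 0 < w i by rewrite exprn_gt0 // lt_def S0 -rE ptsr.
have m0 : (0 < m)%N.
  rewrite lt0n; apply/eqP => m0; move: w1; rewrite big1 => [/eqP|i].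
    by rewrite eq_sym oner_eq0.
  by have := ltn_ord i; rewrite {2}m0.
have [N [gam bal]] := balanced_handicap k0 kn hn pts_inj m0 w0 w1.
pose bas e (V : Gr F n e) : 'M[F]_(e, n) := projT1 (cid (Gr_basis V)).
have basP e (V : Gr F n e) : row_free (bas e V) /\
    forall v, (v \in val V) = (v <= bas e V)%MS := projT2 (cid (Gr_basis V)).
(* Dividing by the total gain on a plane normalizes the plane sums. Basis and gain depend on the
   dimension [e] and not on the index [j], so equal dimensions share one function. *)
pose g e i (V : Gr F n e) : R :=
  (gain (N + m) pts N gam (bas e V) i)%:R / ('C(e + N, e))%:R.
have g0 e i V : 0 <= g e i V by rewrite divr_ge0 ?ler0n.
exists (fun e p V => \sum_(i < m) (p == pts i)%:R * g e i V); split.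
- by move=> j p V; apply: sumr_ge0 => i _; rewrite mulr_ge0 ?ler0n.
- move=> p V; have [pr|/negPn pr] := boolP (p \notin r).
    move: pr; rewrite rE negbK => /eqP ->; rewrite expr0n gtn_eqF // mulr0.
    rewrite mulr_ge0 ?mulr_ge0 ?ler0n // prodr_ge0 // => j _.
    by apply: sumr_ge0 => i _; rewrite mulr_ge0 ?ler0n.
  have [i pE] : exists i, p = pts i.
    have ip : (index p r < m)%N by rewrite index_mem.
    by exists (Ordinal ip); rewrite /pts /= nth_index.
  have sE j : \sum_(i' < m) (p == pts i')%:R * g (k j) i' (V j) = g (k j) i (V j).
    rewrite (bigD1 i) //= pE eqxx mul1r big1 ?addr0 // => i' ii'.
    by rewrite (inj_eq pts_inj) eq_sym (negbTE ii') mul0r.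
  under eq_bigr => j _ do rewrite sE.
  have [VT|_] := boolP (wedge _); last first.
    by rewrite mul0r mulr_ge0 ?mulr_ge0 ?ler0n // prodr_ge0.
  rewrite mul1r pE -/(w i).
  pose B j := bas (k j) (V j).
  have MU : stack kn B \in unitmx.
    by apply: stack_unit VT => j v; have [_ ->] := basP _ (V j).
  have := bal i (exist _ (stack kn B) MU).
  rewrite /frame_gain /=; under eq_bigr => j _ do rewrite block_stack.
  set G := (\prod_(j < d) _)%N => wG.
  pose Q := (\prod_(j < d) 'C(k j + N, k j))%N.
  have Q0 : (0 < Q)%N by rewrite prodn_gt0 // => j; rewrite bin_gt0 leq_addr.
  have -> : \prod_(j < d) g (k j) i (V j) = G%:R / Q%:R.
    by rewrite /g big_split /= prodfV !natr_prod.
  have QM : (Q%:R : R) <= n`!%:R * ('C(n + N, n))%:R.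
    by rewrite -natrM ler_nat; apply: prod_bin_le.
  rewrite mulrA ler_pdivlMr ?ltr0n //.
  have := ler_wpM2l (ltW (w0 i)) QM.
  have n0 : 0 < (n`!%:R : R) by rewrite ltr0n fact_gt0.
  have := ler_wpM2l (ltW n0) wG.
  by lra.
move=> j P; rewrite esum_sum_at //.
have [a aP] := edir_translate P.
(* By [aP] the plane is its direction translated by [- a], which serves as base point for
   [sum_gain_le]. *)
have inP i : pts i \in (P : set _) -> ((pts i - - a)%R <= bas (k j) (edir P))%MS.
  rewrite inE => iP; have [_ <-] := basP _ (edir P); rewrite opprK.
  have : [set v | v \in val (edir P)] (pts i + a) by rewrite aP; exists (pts i).
  by [].
rewrite lee_fin; have [fr _] := basP _ (edir P).
apply: (@le_trans _ _ (\sum_(i < m | ((pts i - - a)%R <= bas (k j) (edir P))%MS)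
    g (k j) i (edir P))).
  rewrite big_mkcond [leRHS]big_mkcond; apply: ler_sum => i _.
  by case: ifP => [/inP -> //|_]; case: ifP.
rewrite -mulr_suml ler_pdivrMr ?ltr0n ?bin_gt0 ?leq_addr // mul1r -natr_sum ler_nat.
by apply: sum_gain_le => //; apply: leq_addr.
Qed.
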